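(* Let $1\le p<\infty$, $m\ge1$, let $X,Y$ be Banach spaces over $\mathbb{K}$ and let $P\in\mathcal{P}(^mX;Y)$. The following are equivalent: (1) $P\in\mathcal{P}_{FSt,p}(^mX;Y)$; (2) the linearization $P_{L,s}:\hat\otimes^{m,s}_{\pi_s}X\to Y$ is absolutely $p$-summing; (3) $\check P\in\Pi_{FSt,p}(^mX;Y)$. In that case, $\|P\|_{FSt,p}=\pi_p(P_{L,s})$.
   Context: $\mathbb{K}=\mathbb{R}$ or $\mathbb{C}$. $\mathcal{P}(^mX;Y)$ is the space of continuous $m$-homogeneous polynomials from $X$ to $Y$, and $\mathcal{P}(^mX)=\mathcal{P}(^mX;\mathbb{K})$ with the sup norm on the unit ball. $\hat\otimes^{m,s}_{\pi_s}X$ is the completion of the span $\otimes^{m,s}X$ of the tensors $x\otimes\cdots\otimes x$ ($m$ factors, $x\in X$) under $\pi_s(z)=\inf\{\sum_{j=1}^k|\lambda_j|\|x_j\|^m: k\in\mathbb{N},\ z=\sum_{j=1}^k\lambda_jx_j\otimes\cdots\otimes x_j\}$. $P_{L,s}$ is the unique continuous linear operator with $P_{L,s}(x\otimes\cdots\otimes x)=P(x)$ for all $x\in X$. $\check P$ is the unique continuous symmetric $m$-linear map $X\times\cdots\times X\to Y$ with $\check P(x,\dots,x)=P(x)$. A continuous linear operator $u:Z\to Y$ is absolutely $p$-summing if there is $C\ge0$ with $\left(\sum_{j=1}^N\|u(z_j)\|^p\right)^{1/p}\le C\sup_{\varphi\in B_{Z^*}}\left(\sum_{j=1}^N|\varphi(z_j)|^p\right)^{1/p}$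 for all $N$ and $z_1,\dots,z_N\in Z$; $\pi_p(u)$ is the infimum of such $C$. $\mathcal{P}_{FSt,p}(^mX;Y)$ (factorable strongly $p$-summing polynomials) consists of those $P\in\mathcal{P}(^mX;Y)$ for which there is $C\ge0$ such that for all positive integers $m_1,m_2$, all $x_j^i\in X$ and all scalars $\lambda_j^i$ ($1\le j\le m_1$, $1\le i\le m_2$), $$\left(\sum_{j=1}^{m_1}\Big\|\sum_{i=1}^{m_2}\lambda_j^iP(x_j^i)\Big\|^p\right)^{1/p}\le C\sup_{q\in\mathcal{P}(^mX),\,\|q\|\le1}\left(\sum_{j=1}^{m_1}\Big|\sum_{i=1}^{m_2}\lambda_j^iq(x_j^i)\Big|^p\right)^{1/p};$$ $\|P\|_{FSt,p}$ is the infimum of such $C$. $\Pi_{FSt,p}(^mX;Y)$ (factorable strongly $p$-summing $m$-linear operators) consists of those continuous $m$-linear $T:X\times\cdots\times X\to Y$ for which there is $C\ge0$ such that for all $m_1,m_2$, all $x_{k,j}^i\in X$ ($1\le k\le m$) and all scalars $\lambda_j^i$, $$\left(\sum_{j=1}^{m_1}\Big\|\sum_{i=1}^{m_2}\lambda_j^iT(x_{1,j}^i,\dots,x_{m,j}^i)\Big\|^p\right)^{1/p}\le C\sup_{\|\varphi\|\le1}\left(\sum_{j=1}^{m_1}\Big|\sum_{i=1}^{m_2}\lambda_j^i\varphi(x_{1,j}^i,\dots,x_{m,j}^i)\Big|^p\right)^{1/p},$$ the supremum being over all continuous $m$-linear forms $\varphi$ on $X\times\cdots\times X$ of norm at most $1$.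 *)

(* Defs.v *)
From HB Require Import structures.
From mathcomp Require Import all_boot all_order all_algebra all_fingroup.
From mathcomp Require Import generic_quotient ring_quotient.
From mathcomp Require Import complex.
From mathcomp Require Import all_classical all_reals all_analysis.
From mathcomp Require Import lra.

Set Implicit Arguments.
Unset Strict Implicit.
Unset Printing Implicit Defensive.

Import Order.TTheory GRing.Theory Num.Theory.
Import numFieldNormedType.Exports.

Local Open Scope classical_set_scope.
Local Open Scope ring_scope.

Variant scalar_kind := RealScalars | ComplexScalars.

Definition KK (R : realType) (k : scalar_kind) : numFieldType :=
  match k with RealScalars => R | ComplexScalars => R[i] end.

Section Scalars.
Variables (R : realType) (k : scalar_kind).
Local Notation K := (KK R k).

Definition to_real : K -> R :=
  match k return KK R k -> R with
  | RealScalars => fun x => x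
  | ComplexScalars => fun x => complex.Re x
  end.

Definition of_real : R -> K :=
  match k return R -> KK R k with
  | RealScalars => fun r => r
  | ComplexScalars => fun r => Complex r 0
  end.

(* In a normed space over K the library norm takes its values in K; [rnorm] is
   the same (nonnegative real) number seen in R. *)
Definition rnorm (V : normedZmodType K) (v : V) : R := to_real `|v|.

End Scalars.

Section ScalarsTheory.
Variables (R : realType) (k : scalar_kind).
Local Notation K := (KK R k).
Implicit Types (x y : K) (r s : R).

Lemma to_realD x y : to_real (x + y) = to_real x + to_real y.
Proof. by move: x y; case: k => //= -[a b] [c d]. Qed.

Lemma ler_to_real x y : x <= y -> to_real x <= to_real y.
Proof. by move: x y; case: k => //= -[a b] [c d]; rewrite lecE => /andP[]. Qed.

Lemma of_realK r : to_real (of_real k r) = r.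
Proof. by case: k. Qed.

Lemma ge0_to_realK x : 0 <= x -> of_real k (to_real x) = x.
Proof. by move: x; case: k => //= -[a b]; rewrite lecE /= => /andP[/eqP ->]. Qed.

Lemma of_realD r s : of_real k (r + s) = of_real k r + of_real k s.
Proof.
case: k => //=; apply/eqP; rewrite eq_complex /= addr0 !eqxx.
by [].
Qed.

Lemma of_realM r s : of_real k (r * s) = of_real k r * of_real k s.
Proof.
case: k => //=; apply/eqP.
by rewrite eq_complex /= !mul0r !mulr0 subr0 addr0 !eqxx.
Qed.

Lemma ler_of_real r s : (of_real k r <= of_real k s) = (r <= s).
Proof. by case: k => //=; rewrite lecE /= eqxx. Qed.

Lemma ltr_of_real r s : (of_real k r < of_real k s) = (r < s).
Proof. by case: k => //=; rewrite ltcE /= eqxx. Qed.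

Lemma of_real0 : of_real k 0 = 0 :> K.
Proof. by case: k. Qed.

Lemma normE (V : normedZmodType K) (v : V) : `|v| = of_real k (rnorm v).
Proof. by rewrite ge0_to_realK. Qed.

Lemma rnorm_ge0 (V : normedZmodType K) (v : V) : 0 <= rnorm v.
Proof. by rewrite -(ler_of_real) -normE of_real0. Qed.

Lemma ler_rnormD (V : normedZmodType K) (v w : V) :
  rnorm (v + w) <= rnorm v + rnorm w.
Proof. by rewrite -ler_of_real of_realD -!normE ler_normD. Qed.

Lemma rnormM x y : rnorm (x * y) = rnorm x * rnorm y.
Proof.
by rewrite -[LHS](of_realK) -normE normrM [`|x|]normE [`|y|]normE -of_realM of_realK.
Qed.

Lemma rnormZ (V : normedModType K) x (v : V) :
  rnorm (x *: v) = rnorm x * rnorm v.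
Proof.
by rewrite -[LHS](of_realK) -normE normrZ [`|x|]normE [`|v|]normE -of_realM of_realK.
Qed.

Lemma rnorm1 : rnorm (1 : K) = 1.
Proof. by rewrite /rnorm normr1; case: k. Qed.

Lemma rnorm0 (V : normedZmodType K) : rnorm (0 : V) = 0.
Proof. by rewrite /rnorm normr0 -of_real0 of_realK. Qed.

Lemma rnormN (V : normedZmodType K) (v : V) : rnorm (- v) = rnorm v.
Proof. by rewrite /rnorm normrN. Qed.

Lemma rnorm_eq0 (V : normedZmodType K) (v : V) : rnorm v = 0 -> v = 0.
Proof. by move=> v0; apply/normr0_eq0; rewrite normE v0 of_real0. Qed.

End ScalarsTheory.

Record seminorm (R : realType) (k : scalar_kind) (V : lmodType (KK R k)) := Seminorm {
  seminorm_fun :> V -> R;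
  ler_seminormD : forall x y,
    seminorm_fun (x + y) <= seminorm_fun x + seminorm_fun y;
  seminormZ : forall (a : KK R k) x,
    seminorm_fun (a *: x) = rnorm a * seminorm_fun x
}.

Section SeminormTheory.
Variables (R : realType) (k : scalar_kind) (V : lmodType (KK R k)).
Variable N : seminorm V.

Lemma seminorm0 : N 0 = 0.
Proof. by rewrite -(scale0r (0 : V)) seminormZ rnorm0 mul0r. Qed.

Lemma seminormN x : N (- x) = N x.
Proof. by rewrite -scaleN1r seminormZ rnormN rnorm1 mul1r. Qed.

Lemma seminorm_ge0 x : 0 <= N x.
Proof.
have := ler_seminormD N x (- x).
by rewrite subrr seminorm0 seminormN -mulr2n pmulrn_lge0.
Qed.

Lemma seminormC x y : N (x - y) = N (y - x).
Proof. by rewrite -opprB seminormN. Qed.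

Lemma ler_seminormB_trans z x y : N (x - y) <= N (x - z) + N (z - y).
Proof. by rewrite (le_trans _ (ler_seminormD _ _ _))// addrA subrK. Qed.

Lemma ler_dist_seminorm x y : `|N x - N y| <= N (x - y).
Proof.
rewrite ler_norml lerBrDr lerBlDr; apply/andP; split.
  rewrite addrC lerBlDr seminormC addrC.
  by rewrite (le_trans _ (ler_seminormD _ _ _))// subrK.
by rewrite (le_trans _ (ler_seminormD _ _ _))// subrK.
Qed.

End SeminormTheory.

(* Cauchy sequences modulo null sequences. The completion of a seminormed space
   is that of the associated normed space, so definiteness of the seminorm is
   not needed to define it; when the seminorm is a norm this is the usual
   completion, see [rnorm_to_completion], [to_completion_dense] and
   [completion_complete]. *)
Section Completion.
Variables (R : realType) (k : scalar_kind) (V : lmodType (KK R k)).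
Variable N : seminorm V.
Local Notation K := (KK R k).

Definition cauchy_seq : pred (nat -> V) := fun s =>
  `[< forall e : R, 0 < e -> exists n0, forall i j, (n0 <= i)%N -> (n0 <= j)%N ->
        N (s i - s j) < e >].

Fact cauchy_seq_submod : GRing.subsemimod_closed cauchy_seq.
Proof.
split; first split.
- apply/asboolP => e e0; exists 0%N => i j _ _.
  by rewrite subrr seminorm0.
- move=> s t /asboolP cs /asboolP ct; apply/asboolP => e e0.
  have e20 : 0 < e / 2 by rewrite divr_gt0.
  have [n1 h1] := cs _ e20; have [n2 h2] := ct _ e20.
  exists (maxn n1 n2) => i j; rewrite !geq_max => /andP[i1 i2] /andP[j1 j2].
  rewrite [X in N X](_ : _ = (s i - s j) + (t i - t j)); last first.
    by rewrite opprD addrACA.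
  rewrite (le_lt_trans (ler_seminormD _ _ _))// [ltRHS]splitr ltrD//.
  - exact: h1.
  - exact: h2.
- move=> a s /asboolP cs; apply/asboolP => e e0.
  have a0 : 0 < rnorm a + 1 by rewrite ltr_wpDl ?rnorm_ge0.
  have [n0 h] := cs (e / (rnorm a + 1)) (divr_gt0 e0 a0).
  exists n0 => i j ni nj; rewrite -[_ - _]scalerBr seminormZ.
  have := h i j ni nj; rewrite ltr_pdivlMr// => /(le_lt_trans _); apply.
  by rewrite mulrC ler_wpM2l ?seminorm_ge0// lerDl.
Qed.

HB.instance Definition _ := GRing.isSubmodClosed.Build K (nat -> V) cauchy_seq
  cauchy_seq_submod.

Record cseq := CSeq { cseq_val :> nat -> V; _ : cseq_val \in cauchy_seq }.

HB.instance Definition _ := [isSub for cseq_val].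
HB.instance Definition _ := [Choice of cseq by <:].
HB.instance Definition _ := [SubChoice_isSubLmodule of cseq by <:].

Definition null_seq : pred cseq := fun s => `[< N (s n) @[n --> \oo] --> (0 : R) >].

Fact null_seq_submod : GRing.subsemimod_closed null_seq.
Proof.
split; first split.
- apply/asboolP; rewrite (_ : (fun _ => _) = cst 0); first exact: cvg_cst.
  by apply/funext => n; rewrite /= seminorm0.
- move=> s t /asboolP cs /asboolP ct; apply/asboolP.
  have := cvgD cs ct; rewrite addr0 => cst0.
  have h : \forall n \near \oo, 0 <= N ((s + t) n) <= N (s n) + N (t n).
    by apply: nearW => n /=; rewrite seminorm_ge0 ler_seminormD.
  exact: (squeeze_cvgr h (cvg_cst 0) (cst0 _)).
- move=> a s /asboolP cs; apply/asboolP.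
  rewrite (_ : (fun _ => _) = (fun n => rnorm a * N (s n))); last first.
    by apply/funext => n; rewrite -seminormZ.
  by have := cvgM (cvg_cst (rnorm a)) cs; rewrite mulr0; apply.
Qed.

HB.instance Definition _ := GRing.isSubmodClosed.Build K cseq null_seq
  null_seq_submod.

Local Notation quot := (Quotient.quot (GRing.ZmodClosed.clone cseq null_seq _)).

Definition completion := quot.

HB.instance Definition _ := GRing.Zmodule.copy completion quot.

Definition completion_class (s : cseq) : completion := (\pi_quot s)%qT.
Definition completion_repr (x : completion) : cseq := repr (x : quot).
Local Notation pi := completion_class.

Lemma completion_reprK x : pi (completion_repr x) = x.
Proof. exact: reprK. Qed.


Lemma pi_eqP (s t : cseq) : reflect (pi s = pi t) (s - t \in null_seq).
Proof. by rewrite Quotient.idealrBE; exact: eqP. Qed.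

Lemma piD (s t : cseq) : pi (s + t) = pi s + pi t.
Proof. exact: (@pi_addr _ _ _ _ _ quot). Qed.

Lemma pi_surj (x : completion) : exists s, x = pi s.
Proof. by exists (completion_repr x); rewrite completion_reprK. Qed.

Definition completion_scale (a : K) (x : completion) : completion :=
  pi (a *: completion_repr x).

Lemma piZ a (s : cseq) : pi (a *: s) = completion_scale a (pi s).
Proof.
apply/pi_eqP; rewrite -scalerBr; apply: rpredZ; apply/pi_eqP.
by rewrite completion_reprK.
Qed.

Fact completion_scaleA a b x :
  completion_scale a (completion_scale b x) = completion_scale (a * b) x.
Proof. by have [s ->] := pi_surj x; rewrite -!piZ scalerA. Qed.
Fact completion_scale1 : left_id 1 completion_scale.
Proof. by move=> x; have [s ->] := pi_surj x; rewrite -!piZ scale1r. Qed.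
Fact completion_scaleDr : right_distributive completion_scale +%R.
Proof.
move=> a x y; have [s ->] := pi_surj x; have [t ->] := pi_surj y.
by rewrite -piD -!piZ -piD scalerDr.
Qed.
Fact completion_scaleDl x : {morph completion_scale^~ x : a b / a + b}.
Proof. by move=> a b; have [s ->] := pi_surj x; rewrite -!piZ -piD scalerDl. Qed.

HB.instance Definition _ := GRing.Zmodule_isLmodule.Build K completion
  completion_scaleA completion_scale1 completion_scaleDr completion_scaleDl.

Definition cseq_norm (s : cseq) : R := lim (N (s n) @[n --> \oo]).


Lemma cseqP (s : cseq) (e : R) : 0 < e -> exists n0, forall i j,
  (n0 <= i)%N -> (n0 <= j)%N -> N (s i - s j) < e.
Proof. by case: s => s /= /asboolP; apply. Qed.

Lemma is_cvg_cseq_norm (s : cseq) : cvg (N (s n) @[n --> \oo]).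
Proof.
apply/cauchy_cvgP/cauchy_exP => e e0; have [n0 h] := cseqP s e0.
exists (N (s n0)); exists n0 => // n /= n0n.
rewrite -ball_normE /=; apply: le_lt_trans (ler_dist_seminorm _ _ _) _.
exact: h.
Qed.

Lemma cseq_norm_ge0 s : 0 <= cseq_norm s.
Proof.
apply: limr_ge; first exact: is_cvg_cseq_norm.
by apply: nearW => n; exact: seminorm_ge0.
Qed.

Lemma cseq_normD s t : cseq_norm (s + t) <= cseq_norm s + cseq_norm t.
Proof.
rewrite /cseq_norm -limD; [|exact: is_cvg_cseq_norm..].
apply: ler_lim; first exact: is_cvg_cseq_norm.
- by apply: is_cvgD; exact: is_cvg_cseq_norm.
- by apply: nearW => n; exact: ler_seminormD.
Qed.

Lemma cseq_normZ a s : cseq_norm (a *: s) = rnorm a * cseq_norm s.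
Proof.
apply/cvg_lim => //.
rewrite (_ : (fun _ => _) = (fun n => rnorm a * N (s n))); last first.
  by apply/funext => n; rewrite -seminormZ.
by apply: cvgM; [exact: cvg_cst|exact: is_cvg_cseq_norm].
Qed.

Lemma cseq_norm_null s : (s \in null_seq) = (cseq_norm s == 0).
Proof.
apply/asboolP/eqP => [s0|<-]; last exact: is_cvg_cseq_norm.
exact: cvg_lim s0.
Qed.

Lemma cseq_norm_eq s t : pi s = pi t -> cseq_norm s = cseq_norm t.
Proof.
move=> /pi_eqP st; have ts : t - s \in null_seq by rewrite -opprB rpredN.
move: st ts; rewrite !cseq_norm_null => /eqP st /eqP ts.
apply/eqP; rewrite eq_le; apply/andP; split.
  by rewrite -[in leLHS](subrK t s) (le_trans (cseq_normD _ _))// st add0r.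
by rewrite -[in leLHS](subrK s t) (le_trans (cseq_normD _ _))// ts add0r.
Qed.

Definition completion_norm (x : completion) : K :=
  of_real k (cseq_norm (completion_repr x)).

Lemma completion_norm_pi s : completion_norm (pi s) = of_real k (cseq_norm s).
Proof. by congr of_real; apply: cseq_norm_eq; rewrite completion_reprK. Qed.

Fact completion_normD x y :
  completion_norm (x + y) <= completion_norm x + completion_norm y.
Proof.
have [s ->] := pi_surj x; have [t ->] := pi_surj y.
by rewrite -piD !completion_norm_pi -of_realD ler_of_real cseq_normD.
Qed.

Fact completion_normZ (a : K) x :
  completion_norm (a *: x) = `|a| * completion_norm x.
Proof.
have [s ->] := pi_surj x.
by rewrite -[a *: _]piZ !completion_norm_pi cseq_normZ of_realM -normE.
Qed.

Fact completion_norm0 x : completion_norm x = 0 -> x = 0.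
Proof.
have [s ->] := pi_surj x; rewrite completion_norm_pi => s0.
rewrite -[RHS](@pi_zeror _ _ _ _ _ quot); apply/pi_eqP.
by rewrite subr0 cseq_norm_null -(of_realK k (cseq_norm s)) s0 -(of_real0 R k) of_realK.
Qed.

HB.instance Definition _ := @Lmodule_isNormed.Build K completion completion_norm
  completion_normD completion_normZ completion_norm0.

Lemma rnorm_pi s : rnorm (pi s) = cseq_norm s.
Proof. by rewrite /rnorm [`|_|]completion_norm_pi of_realK. Qed.

Fact cst_cauchy (v : V) : (fun=> v) \in cauchy_seq.
Proof.
by apply/asboolP => e e0; exists 0%N => i j _ _; rewrite subrr seminorm0.
Qed.

Definition to_completion (v : V) : completion := pi (CSeq (cst_cauchy v)).

Lemma to_completion_is_linear : linear to_completion.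
Proof.
move=> a u v; rewrite /to_completion -[a *: pi _]piZ -piD; congr (pi _).
exact/val_inj.
Qed.

HB.instance Definition _ := GRing.isLinear.Build K V completion _ to_completion
  to_completion_is_linear.

Lemma rnorm_to_completion v : rnorm (to_completion v) = N v.
Proof. by rewrite rnorm_pi; apply/cvg_lim => //=; apply: cvg_cst. Qed.

Lemma to_completion_dense x (e : R) :
  0 < e -> exists v, rnorm (x - to_completion v) < e.
Proof.
have [s ->] := pi_surj x => e0.
have e20 : 0 < e / 2 by rewrite divr_gt0.
have [n0 h] := cseqP s e20; exists (s n0).
rewrite -[_ - _](@pi_is_zmod_morphism _ _ _ quot).
rewrite rnorm_pi; apply: (@le_lt_trans _ _ (e / 2)); last first.
  by rewrite ltr_pdivrMr// ltr_pMr// ltr1n.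
apply: limr_le; first exact: is_cvg_cseq_norm.
by exists n0 => // n /= n0n; apply/ltW/h.
Qed.

Fact completion_complete (F : set_system completion) :
  ProperFilter F -> cauchy F -> cvg F.
Proof.
move=> FF /(cauchyP F) Fc.
pose d n : R := n.+1%:R^-1.
have d0 n : 0 < d n by rewrite invr_gt0.
have ball_rnorm (x y : completion) (e : R) :
    ball x (of_real k e) y = (rnorm (x - y) < e) :> Prop.
  by rewrite -ball_normE /ball_/= normE ltr_of_real.
have /choice[v Fv] n : exists v, F [set x | rnorm (to_completion v - x) < d n + d n].
  have dK : 0 < of_real k (d n) by rewrite -(of_real0 R k) ltr_of_real.
  have [y Fy] := Fc _ dK.
  have [v yv] := to_completion_dense y (d0 n); exists v.
  apply: filterS Fy => x; rewrite ball_rnorm /= => yx.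
  rewrite -(subrK y (to_completion v)) -addrA.
  by rewrite (le_lt_trans (ler_rnormD _ _))// ltrD// -opprB rnormN.
have Nv i j : N (v i - v j) < (d i + d i) + (d j + d j).
  rewrite -rnorm_to_completion linearB /=.
  have [x [/= xi xj]] := filter_ex (filterI (Fv i) (Fv j)).
  rewrite -(subrK x (to_completion (v i))) -addrA.
  by rewrite (le_lt_trans (ler_rnormD _ _))// ltrD// -opprB rnormN.
have dle i j : (i <= j)%N -> d j <= d i.
  by move=> ij; rewrite lef_pV2 ?posrE// ler_nat.
have dsmall (e : R) : 0 < e -> exists n, d n < e.
  move=> e0; exists (Num.trunc e^-1).
  rewrite -[ltRHS]invrK ltf_pV2 ?posrE ?invr_gt0//.
  exact: truncnS_gt.
have vc : v \in cauchy_seq.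
  apply/asboolP => e e0; have [n dn] := dsmall (e / 4) (divr_gt0 e0 (ltr0Sn _ _)).
  exists n => i j ni nj; apply: lt_le_trans (Nv i j) _.
  have := dle _ _ ni; have := dle _ _ nj; lra.
apply/cvg_ex; exists (pi (CSeq vc)); apply/cvgrPdist_lt => e e0.
have er : of_real k (to_real e) = e by rewrite ge0_to_realK// ltW.
have r0 : 0 < to_real e by rewrite -(ltr_of_real k) er of_real0.
have [n dn] := dsmall (to_real e / 6) (divr_gt0 r0 (ltr0Sn _ _)).
apply: filterS (Fv n) => x /= vx; rewrite -er normE ltr_of_real.
rewrite -(subrK (to_completion (v n)) (pi _)) -addrA.
apply: le_lt_trans (ler_rnormD _ _) _.
have : rnorm (pi (CSeq vc) - to_completion (v n)) <= d n *+ 4.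
  rewrite -[_ - _](@pi_is_zmod_morphism _ _ _ quot) rnorm_pi.
  apply: limr_le; first exact: is_cvg_cseq_norm.
  exists n => // i /= ni; apply/ltW; apply: lt_le_trans (Nv i n) _.
  have := dle _ _ ni; rewrite mulrS; lra.
move: vx dn; lra.
Qed.

HB.instance Definition _ := Uniform_isComplete.Build completion
  completion_complete.

End Completion.

Section Multilinear.
Variables (R : realType) (k : scalar_kind) (m : nat).
Local Notation K := (KK R k).
Variables (X Y : normedModType K).

Definition mlinear (A : ('I_m -> X) -> Y) := forall i x (a : K) u v,
  A [eta x with i |-> a *: u + v] =
  a *: A [eta x with i |-> u] + A [eta x with i |-> v].

Definition cmlinear (A : ('I_m -> X) -> Y) :=
  mlinear A /\ continuous (A : {ptws 'I_m -> X} -> Y).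

Definition msymmetric (A : ('I_m -> X) -> Y) :=
  forall (s : 'S_m) x, A (x \o s) = A x.

Definition cpoly (P : X -> Y) :=
  (exists2 A : ('I_m -> X) -> Y, mlinear A & forall x, P x = A (fun=> x)) /\
  continuous P.

(* The continuous symmetric m-linear map with diagonal P: for m >= 1 and [cpoly P]
   it exists and is unique by polarization, so the default value is irrelevant. *)
Definition polar (P : X -> Y) : ('I_m -> X) -> Y :=
  xget (fun=> 0) [set A | [/\ cmlinear A, msymmetric A &
                              forall x, A (fun=> x) = P x]].

Definition mnorm (A : ('I_m -> X) -> Y) : \bar R :=
  ereal_sup [set (rnorm (A x))%:E | x in [set x | forall i, rnorm (x i) <= 1]].

End Multilinear.

(* Supremum over the closed unit ball: the norm of a homogeneous polynomial, or
   of a linear functional. *)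
Definition ball_norm (R : realType) (k : scalar_kind)
    (X Y : normedModType (KK R k)) (f : X -> Y) : \bar R :=
  ereal_sup [set (rnorm (f x))%:E | x in [set x | rnorm x <= 1]].

Arguments cpoly {R k} m {X Y} P.
Arguments polar {R k} m {X Y} P.

Section SymmetricTensor.
Variables (R : realType) (k : scalar_kind) (m : nat).
Local Notation K := (KK R k).
Variable X : normedModType K.

(* All m-linear forms, continuous or not: the m-fold algebraic tensor product is
   realized, faithfully, inside the functions on the space of m-linear forms,
   x_1 (x) ... (x) x_m being evaluation at (x_1, ..., x_m). *)
Definition mform := {A : ('I_m -> X) -> K^o | mlinear A}.

Definition tpow (x : X) : mform -> K^o := fun A => sval A (fun=> x).

Definition tcomb (s : seq (K * X)) : mform -> K^o :=
  \sum_(u <- s) u.1 *: tpow u.2.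

Definition is_symtensor : pred (mform -> K^o) := fun z =>
  `[< exists s, z = tcomb s >].

Definition tscale (a : K) (s : seq (K * X)) := [seq (a * u.1, u.2) | u <- s].

Lemma tcombZ a s : tcomb (tscale a s) = a *: tcomb s.
Proof.
rewrite /tcomb scaler_sumr big_map; apply: eq_bigr => u _.
by rewrite scalerA.
Qed.

Lemma tcomb_cat s t : tcomb (s ++ t) = tcomb s + tcomb t.
Proof. by rewrite /tcomb big_cat. Qed.

Fact is_symtensor_submod : GRing.subsemimod_closed is_symtensor.
Proof.
split; first split.
- by apply/asboolP; exists [::]; rewrite /tcomb big_nil.
- move=> z w /asboolP[s ->] /asboolP[t ->]; apply/asboolP.
  by exists (s ++ t); rewrite tcomb_cat.
- move=> a z /asboolP[s ->]; apply/asboolP.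
  by exists (tscale a s); rewrite tcombZ.
Qed.

HB.instance Definition _ := GRing.isSubmodClosed.Build K (mform -> K^o)
  is_symtensor is_symtensor_submod.

Record symtensor := SymTensor {
  symtensor_val :> mform -> K^o; _ : symtensor_val \in is_symtensor }.

HB.instance Definition _ := [isSub for symtensor_val].
HB.instance Definition _ := [Choice of symtensor by <:].
HB.instance Definition _ := [SubChoice_isSubLmodule of symtensor by <:].

Fact tpow_symtensor x : tpow x \in is_symtensor.
Proof.
by apply/asboolP; exists [:: (1, x)]; rewrite /tcomb big_seq1 scale1r.
Qed.

Definition sympow (x : X) : symtensor := SymTensor (tpow_symtensor x).

Definition tcost (s : seq (K * X)) : R :=
  \sum_(u <- s) rnorm u.1 * rnorm u.2 ^+ m.

Definition pi_s (z : symtensor) : R :=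
  inf [set tcost s | s in [set s | val z = tcomb s]].

Lemma tcost_ge0 s : 0 <= tcost s.
Proof.
by apply: sumr_ge0 => u _; rewrite mulr_ge0 ?exprn_ge0 ?rnorm_ge0.
Qed.

Lemma tcost_has_inf (z : symtensor) :
  has_inf [set tcost s | s in [set s | val z = tcomb s]].
Proof.
split; last by exists 0 => _ [s _ <-]; exact: tcost_ge0.
by case: z => z /= /asboolP[s zs]; exists (tcost s); exists s.
Qed.

Lemma pi_s_le (z : symtensor) s : val z = tcomb s -> pi_s z <= tcost s.
Proof. by move=> zs; apply: inf_lbound; [case: (tcost_has_inf z)|exists s]. Qed.

Lemma pi_s_adherent (z : symtensor) (e : R) : 0 < e ->
  exists2 s, val z = tcomb s & tcost s < pi_s z + e.
Proof.
move=> e0; have [_ [s zs <-] lt] := inf_adherent e0 (tcost_has_inf z).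
by exists s.
Qed.

Fact ler_pi_sD (z w : symtensor) : pi_s (z + w) <= pi_s z + pi_s w.
Proof.
apply/ler_addgt0Pr => e e0; have e20 : 0 < e / 2 by rewrite divr_gt0.
have [s zs lts] := pi_s_adherent z e20; have [t wt ltt] := pi_s_adherent w e20.
have /pi_s_le/le_trans : val (z + w) = tcomb (s ++ t).
  by rewrite tcomb_cat -zs -wt.
by apply; rewrite /tcost big_cat /= -!/(tcost _) [e]splitr addrACA lerD// ltW.
Qed.

Lemma ler_pi_sZ (a : K) (z : symtensor) : pi_s (a *: z) <= rnorm a * pi_s z.
Proof.
apply/ler_addgt0Pr => e e0.
have a0 : 0 < rnorm a + 1 by rewrite ltr_wpDl ?rnorm_ge0.
have [s zs lts] := pi_s_adherent z (divr_gt0 e0 a0).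
have /pi_s_le/le_trans : val (a *: z) = tcomb (tscale a s).
  by rewrite tcombZ -zs.
apply; have -> : tcost (tscale a s) = rnorm a * tcost s.
  rewrite /tcost mulr_sumr big_map; apply: eq_bigr => u _.
  by rewrite rnormM mulrA.
apply: le_trans (ler_wpM2l (rnorm_ge0 _) (ltW lts)) _.
rewrite mulrDr lerD2l mulrCA ler_piMr ?(ltW e0)//.
by rewrite ler_pdivrMr// mul1r lerDl.
Qed.

Fact pi_sZ (a : K) (z : symtensor) : pi_s (a *: z) = rnorm a * pi_s z.
Proof.
apply/eqP; rewrite eq_le ler_pi_sZ /=.
have [->|a0] := eqVneq a 0.
  rewrite rnorm0 mul0r; apply: lb_le_inf; first by case: (tcost_has_inf (0 *: z)).
  by move=> _ [s _ <-]; exact: tcost_ge0.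
have na0 : 0 < rnorm a.
  rewrite lt_neqAle rnorm_ge0 andbT eq_sym.
  by apply: contraNneq a0 => /rnorm_eq0 ->.
have := ler_pi_sZ a^-1 (a *: z); rewrite scalerA mulVf// scale1r.
move=> /(ler_wpM2l (rnorm_ge0 a)); rewrite mulrA -rnormM mulfV// rnorm1.
by rewrite mul1r.
Qed.

Definition pi_s_seminorm : seminorm symtensor := Seminorm ler_pi_sD pi_sZ.

Definition symproj : Type := completion pi_s_seminorm.

HB.instance Definition _ := CompleteNormedModule.copy symproj (completion pi_s_seminorm).

Definition symproj_pow (x : X) : symproj := to_completion pi_s_seminorm (sympow x).

End SymmetricTensor.

Section Linearization.
Variables (R : realType) (k : scalar_kind) (m : nat).
Variables (X Y : normedModType (KK R k)).

(* The continuous linear map sending x (x) ... (x) x to P x: for [cpoly m P] and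
   complete Y it exists and is unique, so the default value is irrelevant. *)
Definition linearization (P : X -> Y) : symproj m X -> Y :=
  xget (fun=> 0) [set u | [/\ linear u, continuous u &
                              forall x, u (symproj_pow m x) = P x]].

End Linearization.

Arguments linearization {R k} m {X Y} P.

Section Summing.
Variables (R : realType) (k : scalar_kind) (p : R).
Local Notation K := (KK R k).

Definition lpnorm n (a : 'I_n -> R) : R := (\sum_(j < n) a j `^ p) `^ p^-1.

Section AbsolutelySumming.
Variables Z Y : normedModType K.

Definition summing_consts (u : Z -> Y) : set R := [set C | 0 <= C /\
  forall N (z : 'I_N -> Z),
    ((lpnorm (fun j => rnorm (u (z j))))%:E <=
     C%:E * ereal_sup [set (lpnorm (fun j => rnorm (f (z j))))%:E | f in
       [set f : Z -> K^o | [/\ linear f, continuous f & ball_norm f <= 1]]])%E].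

Definition abs_summing (u : Z -> Y) :=
  [/\ linear u, continuous u & exists C, summing_consts u C].

Definition summing_norm (u : Z -> Y) : R := inf (summing_consts u).

End AbsolutelySumming.

Section FactorableStrongly.
Variables (m : nat) (X Y : normedModType K).

Definition fst_poly_consts (P : X -> Y) : set R := [set C | 0 <= C /\
  forall m1 m2 (x : 'I_m1 -> 'I_m2 -> X) (l : 'I_m1 -> 'I_m2 -> K),
    (0 < m1)%N -> (0 < m2)%N ->
    ((lpnorm (fun j => rnorm (\sum_(i < m2) l j i *: P (x j i))))%:E <=
     C%:E * ereal_sup
       [set (lpnorm (fun j => rnorm (\sum_(i < m2) l j i *: q (x j i))))%:E |
         q in [set q : X -> K^o | cpoly m q /\ ball_norm q <= 1]])%E].

Definition fst_poly (P : X -> Y) :=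
  cpoly m P /\ exists C, fst_poly_consts P C.

Definition fst_poly_norm (P : X -> Y) : R := inf (fst_poly_consts P).

(* [x j i] is the m-tuple whose h-th entry [x j i h] is x_{h,j}^i. *)
Definition fst_ml_consts (T : ('I_m -> X) -> Y) : set R := [set C | 0 <= C /\
  forall m1 m2 (x : 'I_m1 -> 'I_m2 -> 'I_m -> X) (l : 'I_m1 -> 'I_m2 -> K),
    (0 < m1)%N -> (0 < m2)%N ->
    ((lpnorm (fun j => rnorm (\sum_(i < m2) l j i *: T (x j i))))%:E <=
     C%:E * ereal_sup
       [set (lpnorm (fun j => rnorm (\sum_(i < m2) l j i *: f (x j i))))%:E |
         f in [set f : ('I_m -> X) -> K^o | cmlinear f /\ mnorm f <= 1]])%E].

Definition fst_ml (T : ('I_m -> X) -> Y) :=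
  cmlinear T /\ exists C, fst_ml_consts T C.

End FactorableStrongly.
End Summing.

(* Main.v *)
Require Import Defs.
From HB Require Import structures.
From mathcomp Require Import all_boot all_order all_algebra all_fingroup.
From mathcomp Require Import complex.
From mathcomp Require Import all_classical all_reals all_analysis.
From mathcomp Require Import lra ring.

(** Write Z for the completed symmetric projective tensor power of X and w for
    the linearization of P, so that w sends the power of x to P x.

    For (1) <-> (2), the inequality defining a factorable strongly p-summing
    polynomial is the inequality defining a p-summing operator, tested only on
    finite combinations z_j = sum_i l_j^i x_j^i (x) ... (x) x_j^i. Indeed
    w (z_j) = sum_i l_j^i P (x_j^i), and composition with x |-> x (x) ... (x) x
    is a bijection from the unit ball of the dual of Z onto the unit ball of the
    scalar m-homogeneous polynomials on X, whose inverse is linearization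
    ([cpoly_comp_symproj_pow], [exists_linearization]). Such combinations are
    dense in Z and w is continuous, so Minkowski's inequality ([lpnormD])
    extends the estimate to all of Z. Thus both sides have the very same set of
    admissible constants ([fst_summing_constsE]), which gives the equivalence
    and the equality of the two infima at once.

    For (1) <-> (3), an m-linear form of norm at most 1 restricts to the
    diagonal as a polynomial of norm at most 1, so every constant for the polar
    of P is one for P. Conversely, the polarization formula
      m! Q^(x_1, ..., x_m) = sum_S (-1)^(m - |S|) Q (sum_(i in S) x_i),
    S ranging over the sets of indices, turns a combination of values of the
    polar Q^ into a combination of values of Q, with the same coefficients for
    P and for every scalar polynomial q; and it bounds the polar of q by a
    constant depending on m only when q has norm at most 1
    ([fst_poly_ml_consts]).

    The existence of the polar and of the linearization is part of the proof.
    The formula above is proved by expanding multilinear maps over choice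
    functions ([mlinear_sum], [polarization_diag]); it also yields the
    boundedness, hence the continuity, of the polar. The linearization is well
    defined on algebraic tensors because linear functionals separate the points
    of Y ([separating_functional], by Zorn's lemma), so that scalar m-linear
    forms detect relations between vector-valued ones ([wsum_wd]); it is bounded
    for the projective norm and extends by completeness
    ([extend_completion]). *)

Set Implicit Arguments.
Unset Strict Implicit.
Unset Printing Implicit Defensive.
Import Order.TTheory GRing.Theory Num.Theory.
Import numFieldNormedType.Exports.
Local Open Scope classical_set_scope.
Local Open Scope ring_scope.

(** * Multilinear maps and polarization *)

Section LinearFunctions.
Variables (F : pzRingType) (U V : lmodType F) (u : U -> V).
Hypothesis ulin : linear u.

Lemma linear_fun0 : u 0 = 0.
Proof.
by have := ulin (-1) 0 0; rewrite !scaleN1r oppr0 addr0 addNr.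
Qed.

Lemma linear_funD a b : u (a + b) = u a + u b.
Proof. by have := ulin 1 a b; rewrite !scale1r. Qed.

Lemma linear_funZ c a : u (c *: a) = c *: u a.
Proof. by have := ulin c a 0; rewrite linear_fun0 !addr0. Qed.

Lemma linear_funB a b : u (a - b) = u a - u b.
Proof. by rewrite linear_funD -scaleN1r linear_funZ scaleN1r. Qed.

Lemma linear_fun_sum (I : Type) (r : seq I) (Q : pred I) (f : I -> U) :
  u (\sum_(i <- r | Q i) f i) = \sum_(i <- r | Q i) u (f i).
Proof. exact: (big_morph u linear_funD linear_fun0). Qed.

End LinearFunctions.

Section MultilinearAlgebra.
Variables (R : realType) (k : scalar_kind) (m : nat).
Local Notation K := (KK R k).
Variables (X Y : normedModType K) (A : ('I_m -> X) -> Y).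
Hypothesis Alin : mlinear A.
Implicit Types x y : 'I_m -> X.

Lemma mlinear_update0 x i : A [eta x with i |-> 0] = 0.
Proof.
have := Alin i x 1 0 0.
rewrite scale1r addr0 scale1r => e.
by apply: (addrI (A [eta x with i |-> 0])); rewrite addr0 -e.
Qed.

Lemma mlinear_updateZ x i (a : K) u :
  A [eta x with i |-> a *: u] = a *: A [eta x with i |-> u].
Proof. by rewrite -[a *: u]addr0 Alin mlinear_update0 addr0. Qed.

Lemma mlinear_update_sum (I : finType) x i (F : I -> X) :
  A [eta x with i |-> \sum_j F j] = \sum_j A [eta x with i |-> F j].
Proof.
apply: (big_morph (fun u => A [eta x with i |-> u])).
  by move=> u v; have := Alin i x 1 u v; rewrite !scale1r.
exact: mlinear_update0.
Qed.

Lemma update_id x i : [eta x with i |-> x i] = x :> (_ -> _).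
Proof. by apply/funext => j /=; case: eqP => // ->. Qed.

Lemma mlinear0 x i : x i = 0 -> A x = 0.
Proof. by move=> x0; rewrite -(update_id x i) x0 mlinear_update0. Qed.

Lemma mlinearZ (c : 'I_m -> K) x :
  A (fun j => c j *: x j) = (\prod_j c j) *: A x.
Proof.
suff H (r : seq 'I_m) : uniq r ->
    A (fun j => if j \in r then c j *: x j else x j) = (\prod_(j <- r) c j) *: A x.
  have := H (index_enum 'I_m) (index_enum_uniq _).
  by under eq_fun do rewrite mem_index_enum.
elim: r => [_|i r IH /= /andP[ir ur]].
  by rewrite big_nil scale1r.
rewrite big_cons -scalerA -IH// -(update_id (fun j => if j \in r then _ else _) i).
rewrite (negbTE ir) -mlinear_updateZ; congr A; apply/funext => j /=.
by rewrite inE; case: eqP => // ->.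
Qed.

(** Expansion of a multilinear map over all choices of one summand per slot.
    The sum [h r], in which the slots of [r] only have been expanded, runs over
    all choice functions; as the summand ignores their values outside [r],
    expanding one more slot divides the sum by [#|I|]. *)
Lemma mlinear_sum (I : finType) (F : 'I_m -> I -> X) : (0 < #|I|)%N ->
  A (fun j => \sum_i F j i) = \sum_(f : {ffun 'I_m -> I}) A (fun j => F j (f j)).
Proof.
move=> I0; pose S j := \sum_i F j i.
pose h (r : seq 'I_m) := \sum_(f : {ffun 'I_m -> I})
  A (fun j => if j \in r then F j (f j) else S j).
have step i r : i \notin r -> h r = h (i :: r) *+ #|I|.
  move=> ir.
  pose upd (f : {ffun 'I_m -> I}) a := [ffun j => if j == i then a else f j].
  pose g f := A (fun j => if j \in i :: r then F j ((f : {ffun 'I_m -> I}) j) else S j).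
  have -> : h r = \sum_f \sum_a g (upd f a).
    apply: eq_bigr => f _; rewrite -(update_id (fun j => if _ then _ else _) i).
    rewrite (negbTE ir) mlinear_update_sum; apply: eq_bigr => a _.
    congr A; apply/funext => j /=; rewrite inE ffunE.
    by case: eqP => // ->.
  (* exchanging [a] with the value of [f] at [i] is an involution *)
  pose sw (u : {ffun 'I_m -> I} * I) := (upd u.1 u.2, u.1 i).
  have swK : involutive sw.
    move=> [f a]; rewrite /sw /= ffunE eqxx; congr pair.
    by apply/ffunP => j; rewrite !ffunE; case: eqP => // ->.
  rewrite pair_big /= (reindex_inj (inv_inj swK)) /=.
  rewrite -(pair_big predT predT (fun f a => g (upd (upd f a) (f i)))) /=.
  rewrite /h -sumrMnl; apply: eq_bigr => f _.
  rewrite -[RHS]sumr_const; apply: eq_bigr => a _; congr g.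
  by apply/ffunP => j; rewrite !ffunE; case: eqP => // ->.
have H (r : seq 'I_m) : uniq r -> h [::] = h r *+ (#|I| ^ size r).
  elim: r => [_|i r IH /= /andP[ir ur]]; first by rewrite mulr1n.
  by rewrite IH// (step i r ir) -mulrnA expnS.
have := H (enum 'I_m) (enum_uniq _); rewrite size_enum_ord.
have -> : h (enum 'I_m) = \sum_(f : {ffun 'I_m -> I}) A (fun j => F j (f j)).
  by apply: eq_bigr => f _; congr A; apply/funext => j; rewrite mem_enum.
have -> : h [::] = A S *+ (#|I| ^ m).
  by rewrite -[in RHS](card_ord m) -card_ffun -sumr_const; apply: eq_bigl.
rewrite -[_ *+ _]scaler_nat -[RHS]scaler_nat.
by apply: scalerI; rewrite pnatr_eq0 -lt0n expn_gt0 I0.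
Qed.

End MultilinearAlgebra.

Section Polarization.
Variables (R : realType) (k : scalar_kind) (m : nat).
Local Notation K := (KK R k).

(** The polarization formula, for an arbitrary function [P] between modules: an
    alternating sum over the sets of slots; see [polarization_diag] for its
    meaning when [P] is the diagonal of a multilinear map. *)
Definition polarization (X Y : lmodType K) (P : X -> Y) (x : 'I_m -> X) : Y :=
  m`!%:R^-1 *: \sum_(S : {set 'I_m}) (-1) ^+ #|~: S| *: P (\sum_(i in S) x i).

Lemma polarization_comp (X Y Z : lmodType K) (g : Y -> Z) (P : X -> Y) x :
  linear g -> g (polarization P x) = polarization (g \o P) x.
Proof.
move=> glin; rewrite /polarization (linear_funZ glin); congr (_ *: _).
rewrite (linear_fun_sum glin); apply: eq_bigr => S _.
exact: linear_funZ.
Qed.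

Variables (X Y : normedModType K) (A : ('I_m -> X) -> Y).
Hypotheses (m0 : (0 < m)%N) (Alin : mlinear A).

Lemma fact_neq0 : m`!%:R != 0 :> K.
Proof. by rewrite pnatr_eq0 -lt0n fact_gt0. Qed.

(** Inclusion-exclusion: the alternating sum over the sets containing the image
    of [f] vanishes unless [f] is onto, hence one-to-one. *)
Lemma sum_sign_image (f : 'I_m -> 'I_m) :
  \sum_(S : {set 'I_m}) (-1) ^+ #|~: S| * \prod_j (f j \in S)%:R =
  (injectiveb f)%:R :> K.
Proof.
pose c i : K := (i \in codom f)%:R.
transitivity (\prod_i c i).
  transitivity (\prod_i (1 + (c i - 1))); last first.
    by apply: eq_bigr => i _; rewrite addrC subrK.
  rewrite bigA_distr; apply: eq_bigr => S _.
  have [fS|] := boolP [forall j, f j \in S].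
    rewrite big1 ?mulr1; last by move=> j _; rewrite (forallP fS).
    rewrite -prodr_const [RHS](bigID (mem S)) /= [X in _ = X * _]big1 ?mul1r; last first.
      by move=> i ->.
    rewrite (eq_bigl (fun i => i \notin S)); last by move=> i; rewrite !inE.
    apply: eq_bigr => i iS; rewrite (negbTE iS) /c.
    case: codomP => [[j ji]|]; last by rewrite sub0r.
    by rewrite ji (forallP fS) in iS.
  move=> /forallPn[j jS]; rewrite (bigD1 j)//= (negbTE jS) mul0r mulr0.
  rewrite [RHS](bigD1 (f j))//= (negbTE jS).
  by rewrite /c codom_f subrr mul0r.
have [/injectiveP fi|] := boolP (injectiveb f).
  rewrite big1// => i _; rewrite /c.
  have [g _ gK] := injF_bij fi.
  by rewrite -(gK i) codom_f.
move=> fni.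
have /existsP[i ni] : [exists i, i \notin codom f].
  apply: contraR fni; rewrite negb_exists => /forallP fs.
  suff /image_injP finj : #|codom f| == #|'I_m|.
    by apply/injectiveP => i j; exact: finj.
  apply/eqP/eq_card => i; rewrite inE; have := fs i; rewrite negbK => ->.
  by [].
by rewrite (bigD1 i)//= /c (negbTE ni) mul0r.
Qed.

(** The polarization of the diagonal of a multilinear map is its
    symmetrization. *)
Lemma polarization_diag x :
  polarization (fun u => A (fun=> u)) x =
  m`!%:R^-1 *: \sum_(s : 'S_m) A (x \o s).
Proof.
apply: (congr1 ( *:%R _)).
transitivity (\sum_(S : {set 'I_m}) \sum_(f : {ffun 'I_m -> 'I_m})
   ((-1) ^+ #|~: S| * \prod_j (f j \in S)%:R) *: A (x \o f)).
  apply: eq_bigr => S _.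
  have -> : (fun _ : 'I_m => \sum_(i in S) x i) =
            (fun _ => \sum_i (i \in S)%:R *: x i).
    apply/funext => _; rewrite big_mkcond; apply: eq_bigr => i _.
    by case: ifP; rewrite ?scale1r ?scale0r.
  rewrite (mlinear_sum Alin) ?card_ord// scaler_sumr; apply: eq_bigr => f _.
  by rewrite -scalerA -(mlinearZ Alin).
rewrite exchange_big /=.
under eq_bigr do rewrite -scaler_suml sum_sign_image.
rewrite (bigID (fun f : {ffun 'I_m -> 'I_m} => injectiveb f)) /=.
rewrite addrC big1 ?add0r; last first.
  by move=> f /negbTE ->; rewrite scale0r.
rewrite (reindex (@pval _)) /=; last first.
  pose in_Sm := insubd (1%g : 'S_m).
  by exists in_Sm => /= f Uf; first apply: val_inj; apply: insubdK.
apply: eq_big => [s|s _]; rewrite ?(valP s)//= scale1r pvalE.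
by [].
Qed.

Lemma sum_perm_const (y : Y) : m`!%:R^-1 *: (\sum_(s : 'S_m) y) = y.
Proof.
by rewrite sumr_const card_Sn -[y *+ _]scaler_nat scalerA mulVf ?fact_neq0// scale1r.
Qed.

Lemma polarization_symm : msymmetric A -> polarization (fun u => A (fun=> u)) = A.
Proof.
move=> As; apply/funext => x; rewrite polarization_diag.
by under eq_bigr do rewrite As; exact: sum_perm_const.
Qed.

Lemma polarization_cst u : polarization (fun u => A (fun=> u)) (fun=> u) = A (fun=> u).
Proof. by rewrite polarization_diag; exact: (sum_perm_const (A (fun=> u))). Qed.

Lemma mlinear_polarization : mlinear (polarization (fun u => A (fun=> u))).
Proof.
have updE (x : 'I_m -> X) i u (s : 'S_m) :
    [eta x with i |-> u] \o s = [eta (x \o s) with (s^-1)%g i |-> u] :> (_ -> _).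
  apply/funext => j /=; rewrite -(inj_eq (@perm_inj _ s)) permKV.
  by [].
move=> i x a u v; rewrite !polarization_diag scalerA mulrC -scalerA -scalerDr.
apply: (congr1 (fun z => _ *: z)); rewrite scaler_sumr -big_split /=.
by apply: eq_bigr => s _; rewrite !updE Alin.
Qed.

Lemma msymmetric_polarization : msymmetric (polarization (fun u => A (fun=> u))).
Proof.
move=> s x; rewrite !polarization_diag [in RHS](reindex_inj (mulIg s)) /=.
apply: (congr1 (fun z => _ *: z)); apply: eq_bigr => t _.
by congr A; apply/funext => i; rewrite /= permM.
Qed.

End Polarization.

(** * Real-valued norms, boundedness and continuity *)

Section RealNorm.
Variables (R : realType) (k : scalar_kind).
Local Notation K := (KK R k).

(** Neighborhoods described by the real-valued norm. *)
Lemma nbhs_rnormP (V : normedModType K) (x : V) (U : set V) :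
  nbhs x U <-> exists2 e : R, 0 < e & forall y, rnorm (x - y) < e -> U y.
Proof.
split=> [/nbhs_ballP[e /= e0 H]|[e e0 H]].
  exists (to_real e); first by rewrite -(ltr_of_real k) ge0_to_realK ?of_real0// ltW.
  move=> y xy; apply: H; rewrite -ball_normE /= normE -[e]ge0_to_realK ?(ltW e0)//.
  by rewrite ltr_of_real.
apply/nbhs_ballP; exists (of_real k e); first by rewrite /= -(of_real0 R k) ltr_of_real.
by move=> y; rewrite -ball_normE /= normE ltr_of_real => /H.
Qed.

Lemma rnorm_of_real (r : R) : 0 <= r -> @rnorm R k K (of_real k r) = r.
Proof.
move=> r0; rewrite /rnorm ger0_norm ?of_realK//.
by rewrite -(of_real0 R k) ler_of_real.
Qed.

Lemma of_realV (r : R) : of_real k r^-1 = (of_real k r)^-1.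
Proof.
have [->|r0] := eqVneq r 0; first by rewrite invr0 of_real0 invr0.
have r0' : of_real k r != 0.
  by apply: contra_neq r0 => r0; rewrite -[LHS](of_realK k) r0 -(of_real0 R k) of_realK.
apply: (mulIf r0'); rewrite mulVf// -of_realM mulVf//.
by rewrite -(rnorm1 R k) -normE normr1.
Qed.

Lemma rnormV (a : K) : @rnorm R k K a^-1 = (rnorm a)^-1.
Proof. by rewrite -[LHS](of_realK k) -normE normfV normE -of_realV of_realK. Qed.

Lemma rnormX (a : K) n : @rnorm R k K (a ^+ n) = rnorm a ^+ n.
Proof. by elim: n => [|n IH]; rewrite ?expr0 ?rnorm1// !exprS rnormM IH. Qed.

Lemma rnorm_sum (V : normedZmodType K) (I : Type) (r : seq I) (Q : pred I) (F : I -> V) :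
  rnorm (\sum_(i <- r | Q i) F i) <= \sum_(i <- r | Q i) rnorm (F i).
Proof.
elim/big_rec2: _ => [|i a b _ ab]; first by rewrite rnorm0.
by apply: le_trans (ler_rnormD _ _) _; rewrite lerD2l.
Qed.

Lemma rnorm_gt0 (V : normedModType K) (x : V) : x != 0 -> 0 < rnorm x.
Proof.
move=> x0; rewrite lt_neqAle rnorm_ge0 andbT eq_sym.
by apply: contra_neq x0; exact: rnorm_eq0.
Qed.

Lemma rnormB (V : normedModType K) (x y : V) : rnorm (x - y) = rnorm (y - x).
Proof. by rewrite -opprB rnormN. Qed.

Lemma rnorm_normalize (V : normedModType K) (x : V) :
  exists2 u : V, rnorm u <= 1 & x = of_real k (rnorm x) *: u.
Proof.
exists ((of_real k (rnorm x))^-1 *: x).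
  rewrite rnormZ rnormV rnorm_of_real ?rnorm_ge0//.
  have [->|x0] := eqVneq x 0; first by rewrite rnorm0 mulr0.
  by rewrite mulVf// gt_eqF// rnorm_gt0.
have [->|x0] := eqVneq x 0; first by rewrite !scaler0.
rewrite scalerA mulfV ?scale1r//; apply: contra_neq x0 => x0.
by apply: (@rnorm_eq0 R k); rewrite -[LHS](of_realK k) x0 -(of_real0 R k) of_realK.
Qed.

Lemma continuous_rnorm (T : topologicalType) (Y : normedModType K) (f : T -> Y) :
  (forall x (e : R), 0 < e -> nbhs x [set y | rnorm (f x - f y) < e]) ->
  continuous f.
Proof.
move=> H x U /nbhs_rnormP[e e0 eU].
by apply: filterS (H x e e0) => y; exact: eU.
Qed.

Lemma ball_norm_le1P (X Y : normedModType K) (f : X -> Y) :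
  (ball_norm f <= 1)%E <-> forall x, rnorm x <= 1 -> rnorm (f x) <= 1.
Proof.
split=> [H x x1|H].
  rewrite -lee_fin; apply: le_trans H; apply: ereal_sup_ubound.
  by exists x.
by apply: ge_ereal_sup => _ [x x1 <-]; rewrite lee_fin; exact: H.
Qed.

Lemma mnorm_le1P m (X Y : normedModType K) (f : ('I_m -> X) -> Y) :
  (mnorm f <= 1)%E <-> forall x, (forall i, rnorm (x i) <= 1) -> rnorm (f x) <= 1.
Proof.
split=> [H x x1|H].
  rewrite -lee_fin; apply: le_trans H; apply: ereal_sup_ubound.
  by exists x.
by apply: ge_ereal_sup => _ [x x1 <-]; rewrite lee_fin; exact: H.
Qed.

End RealNorm.

Section MultilinearContinuity.
Variables (R : realType) (k : scalar_kind) (m : nat).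
Local Notation K := (KK R k).
Variables (X Y : normedModType K).

Lemma mlinear_bound (A : ('I_m -> X) -> Y) (M : R) : mlinear A ->
  (forall x, (forall i, rnorm (x i) <= 1) -> rnorm (A x) <= M) ->
  forall x, rnorm (A x) <= M * \prod_i rnorm (x i).
Proof.
move=> Alin AM x.
have /choice[u hu] : forall i, exists u : X,
    rnorm u <= 1 /\ x i = of_real k (rnorm (x i)) *: u.
  by move=> i; have [u] := rnorm_normalize (x i); exists u.
have -> : A x = (\prod_i of_real k (rnorm (x i))) *: A u.
  rewrite -(mlinearZ Alin); congr A; apply/funext => i; exact: (hu i).2.
have -> : \prod_i of_real k (rnorm (x i)) = of_real k (\prod_i rnorm (x i)).
  apply/esym/(big_morph (of_real k)); first exact: of_realM.
  by rewrite -(rnorm1 R k) -normE normr1.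
have p0 : 0 <= \prod_i rnorm (x i) by apply: prodr_ge0 => i _; exact: rnorm_ge0.
rewrite rnormZ rnorm_of_real// mulrC ler_wpM2r// AM// => i; exact: (hu i).1.
Qed.

(** Boundedness on the unit polyball gives continuity: expand [A (x + h)] over
    the choices of [x j] or [h j] in each slot. *)
Lemma mlinear_continuous (A : ('I_m -> X) -> Y) (M : R) : mlinear A ->
  (forall x, (forall i, rnorm (x i) <= 1) -> rnorm (A x) <= M) ->
  continuous (A : {ptws 'I_m -> X} -> Y).
Proof.
move=> Alin AM; apply: continuous_rnorm => x e e0.
have M0 : 0 <= M.
  apply: le_trans (AM (fun=> 0) _); first exact: rnorm_ge0.
  by move=> i; rewrite rnorm0.
(* [B] bounds every [x i], and every [y i - x i] since [d <= 1] *)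
pose B := 1 + \sum_i rnorm (x i).
have s0 : 0 <= \sum_i rnorm (x i) by apply: sumr_ge0 => i _; exact: rnorm_ge0.
have B1 : 1 <= B by rewrite lerDl.
have xB i : rnorm (x i) <= B.
  rewrite /B (bigD1 i)//= addrCA lerDl addr_ge0//.
  by apply: sumr_ge0 => j _; exact: rnorm_ge0.
pose n := #|{ffun 'I_m -> bool}|.
pose L : R := n%:R * M * B ^+ m + 1.
have L0 : 0 < L.
  by rewrite ltr_wpDl// !mulr_ge0// exprn_ge0// (le_trans ler01).
pose d := Num.min 1 (e / L).
have d0 : 0 < d by rewrite lt_min ltr01 divr_gt0.
have d1 : d <= 1 by rewrite ge_min lexx.
pose T : topologicalType := {ptws 'I_m -> X}.
pose W : set T := [set y | forall i, rnorm (x i - y i) < d].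
have xW : @nbhs T T x W.
  pose Wi i : set T := [set y : T | rnorm (x i - y i) < d].
  apply: (@filter_forall T _ Wi (@nbhs T T x) (@nbhs_filter T x)).
  move=> i; apply: (@proj_continuous _ (fun=> X) i x [set z | rnorm (x i - z) < d]).
  by apply/nbhs_rnormP; exists d.
apply: (@filterS T (@nbhs T T x) (@nbhs_filter T x) W) xW => y /= yd.
have yE : A y = \sum_(f : {ffun 'I_m -> bool})
    A (fun j => if f j then y j - x j else x j).
  rewrite -(mlinear_sum (I := bool) Alin
    (fun j b => if b then y j - x j else x j)) ?card_bool//.
  by congr A; apply/funext => j; rewrite big_bool /= subrK.
(* the constant choice [false] contributes [A x]; every other choice selects at
   least one small slot [y i - x i] *)
rewrite yE rnormB (bigD1 [ffun=> false])//=.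
have -> : (fun j => if [ffun=> false] j then y j - x j else x j) = x.
  by apply/funext => j; rewrite ffunE.
rewrite addrAC subrr add0r.
apply: le_lt_trans (rnorm_sum _ _ _) _.
apply: (@le_lt_trans _ _ (n%:R * (M * (d * B ^+ m)))).
  rewrite mulr_natl.
  apply: le_trans (_ : _ <= \sum_(f : {ffun 'I_m -> bool} | f != [ffun=> false])
    M * (d * B ^+ m)) _.
    apply: ler_sum => f fn0.
    have /existsP[i fi] : [exists i, f i].
      apply: contraR fn0; rewrite negb_exists => /forallP f0.
      by apply/eqP/ffunP => i; rewrite ffunE; exact: negbTE.
    apply: le_trans (mlinear_bound Alin AM _) _; rewrite ler_wpM2l//.
    have dB j : rnorm (x j - y j) <= B by rewrite (le_trans (ltW (yd j)))// (le_trans d1).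
    rewrite (bigD1 i)//= fi; apply: ler_pM; rewrite ?rnorm_ge0//.
    - by apply: prodr_ge0 => j _; exact: rnorm_ge0.
    - by rewrite rnormB ltW.
    apply: (@le_trans _ _ (\prod_(j < m | j != i) B)).
      apply: ler_prod => j _; rewrite rnorm_ge0/=.
      by case: ifP => _ //; rewrite rnormB.
    rewrite prodr_const; apply: ler_weXn2l => //.
    by rewrite -[leqRHS](card_ord m); exact: max_card.
  rewrite sumr_const ler_wpMn2l//.
    by rewrite !mulr_ge0 ?(ltW d0)// exprn_ge0// (le_trans ler01).
  exact: max_card.
rewrite (_ : _ * _ = (n%:R * M * B ^+ m) * d); last by ring.
apply: (@lt_le_trans _ _ (L * d)); first by rewrite ltr_pM2r// ltrDl.
by rewrite mulrC -ler_pdivlMr// ge_min lexx orbT.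
Qed.

Lemma continuous_diag : continuous ((fun x _ => x) : X -> {ptws 'I_m -> X}).
Proof.
move=> x; apply/cvg_sup => i; apply/cvg_image.
  apply/seteqP; split => // u _; exists (fun=> u) => //.
move=> U nU; exists ((@proj _ (fun=> X) i) @^-1` U); first exact: nU.
apply/seteqP; split => [u [f /= Uf <-]//|u Uu].
by exists (fun=> u).
Qed.

Lemma cmlinear_cpoly (A : ('I_m -> X) -> Y) :
  cmlinear A -> cpoly m (fun x => A (fun=> x)).
Proof.
move=> [Al Ac]; split; first by exists A.
move=> x; apply: (@continuous_comp _ _ _ ((fun x _ => x) : X -> {ptws 'I_m -> X}) A).
  exact: continuous_diag.
exact: Ac.
Qed.

End MultilinearContinuity.

Section Polynomials.
Variables (R : realType) (k : scalar_kind) (m : nat).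
Local Notation K := (KK R k).
Hypothesis m0 : (0 < m)%N.
Variables (X Y : normedModType K).

Lemma cpolyZ (P : X -> Y) (a : K) x : cpoly m P -> P (a *: x) = a ^+ m *: P x.
Proof.
move=> [[A Al PA] _]; rewrite !PA (mlinearZ Al (fun=> a)).
by rewrite prodr_const card_ord.
Qed.

Lemma cpoly_le (P : X -> Y) (M : R) : cpoly m P ->
  (forall x, rnorm x <= 1 -> rnorm (P x) <= M) ->
  forall x, rnorm (P x) <= M * rnorm x ^+ m.
Proof.
move=> Pp PM x; have [u u1 xu] := rnorm_normalize x.
rewrite {1}xu (cpolyZ _ _ Pp) rnormZ rnormX rnorm_of_real ?rnorm_ge0// mulrC.
by rewrite ler_wpM2r ?exprn_ge0 ?rnorm_ge0// PM.
Qed.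

Lemma cpoly_bounded (P : X -> Y) : cpoly m P ->
  exists2 M : R, 0 <= M & forall x, rnorm (P x) <= M * rnorm x ^+ m.
Proof.
move=> Pp; have [[A Al PA] Pc] := Pp.
have P0 : P 0 = 0 by rewrite PA (mlinear0 Al (i := Ordinal m0)).
have /nbhs_rnormP[d d0 H] : nbhs (0 : X) [set y | rnorm (P 0 - P y) < 1].
  by apply: (Pc 0 [set z | rnorm (P 0 - z) < 1]); apply/nbhs_rnormP; exists 1.
have d20 : 0 < (d / 2) ^+ m by rewrite exprn_gt0// divr_gt0.
exists ((d / 2) ^+ m)^-1; first by rewrite invr_ge0 ltW.
apply: cpoly_le => // x x1.
have := H (of_real k (d / 2) *: x); rewrite /= P0 !sub0r !rnormN (cpolyZ _ _ Pp).
rewrite !rnormZ rnormX rnorm_of_real; last by rewrite ltW// divr_gt0.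
move=> h; rewrite -[leRHS]mulr1 ler_pdivlMl// ltW// h//.
rewrite (@le_lt_trans _ _ (d / 2))//; last by lra.
by rewrite ler_piMr// ltW// divr_gt0.
Qed.

(** A bound, depending on [m] only, for the polarization of a polynomial of norm
    at most 1; it is cruder than the classical [m ^ m / m!], but only its
    finiteness matters. *)
Definition polarization_const : R :=
  rnorm (m`!%:R^-1 : K^o) * (m%:R ^+ m *+ #|{set 'I_m}|).

Lemma polarization_const_ge0 : 0 <= polarization_const.
Proof. by rewrite mulr_ge0 ?rnorm_ge0// mulrn_wge0// exprn_ge0. Qed.

Lemma polarization_le (P : X -> Y) (M : R) (x : 'I_m -> X) : 0 <= M ->
  (forall x, rnorm (P x) <= M * rnorm x ^+ m) ->
  (forall i, rnorm (x i) <= 1) ->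
  rnorm (polarization P x) <= polarization_const * M.
Proof.
move=> M0 PM x1; rewrite rnormZ /polarization_const -mulrA ler_wpM2l ?rnorm_ge0//.
apply: le_trans (rnorm_sum _ _ _) _.
rewrite mulrnAl -sumr_const; apply: ler_sum => S _.
rewrite rnormZ rnormX rnormN rnorm1 expr1n mul1r mulrC.
apply: le_trans (PM _) _; rewrite ler_wpM2l// lerXn2r ?nnegrE ?rnorm_ge0//.
apply: le_trans (rnorm_sum _ _ _) _.
apply: (@le_trans _ _ (\sum_(i in S) (1 : R))); first by apply: ler_sum.
rewrite sumr_const ler_nat -[leqRHS](card_ord m).
exact: max_card.
Qed.

Lemma cmlinear_polarization (A : ('I_m -> X) -> Y) (M : R) : mlinear A -> 0 <= M ->
  (forall x, rnorm (A (fun=> x)) <= M * rnorm x ^+ m) ->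
  cmlinear (polarization (m := m) (fun x => A (fun=> x))).
Proof.
move=> Al M0 AM; split; first exact: mlinear_polarization.
apply: mlinear_continuous; first exact: mlinear_polarization.
by move=> x x1; exact: polarization_le M0 AM x1.
Qed.

(** Converse of boundedness: a bounded diagonal of a multilinear map is
    continuous, being also the diagonal of its continuous polarization. *)
Lemma cpoly_diag (A : ('I_m -> X) -> Y) (M : R) : mlinear A -> 0 <= M ->
  (forall x, rnorm (A (fun=> x)) <= M * rnorm x ^+ m) ->
  cpoly m (fun x => A (fun=> x)).
Proof.
move=> Al M0 AM; have := cmlinear_cpoly (cmlinear_polarization Al M0 AM).
by congr cpoly; apply/funext => x; exact: polarization_cst.
Qed.

Lemma cpoly_polarization (P : X -> Y) : cpoly m P ->
  [/\ cmlinear (polarization (m := m) P), msymmetric (polarization (m := m) P) &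
      forall x, polarization P (fun _ : 'I_m => x) = P x].
Proof.
move=> Pp; have [M M0 PM] := cpoly_bounded Pp.
have [[A Al PA] _] := Pp.
have {}PA : P = fun x => A (fun=> x) by apply/funext.
rewrite PA in PM *; split; first exact: cmlinear_polarization M0 PM.
- exact: msymmetric_polarization.
- by move=> x; exact: polarization_cst.
Qed.

Lemma polarP (P : X -> Y) : cpoly m P ->
  [/\ cmlinear (polar m P), msymmetric (polar m P) &
      forall x, polar m P (fun=> x) = P x].
Proof.
move=> Pp; rewrite /polar; case: xgetP => [B -> []//|].
by move=> /(_ (polarization P)); case; exact: cpoly_polarization.
Qed.

Lemma polarE (P : X -> Y) : cpoly m P -> polar m P = polarization P.
Proof.
move=> /polarP[[Bl _] Bs BP].
by rewrite -[LHS](polarization_symm m0 Bl Bs); congr polarization; apply/funext.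
Qed.

End Polynomials.

(** * Linear functionals, completeness and extension of bounded maps *)

Section SeparatingFunctional.
Variables (F : fieldType) (V : lmodType F).

(** Algebraic Hahn-Banach: a maximal subspace avoiding [y] is a hyperplane, whose
    complement is spanned by [y]. *)
Lemma separating_functional (y : V) : y != 0 ->
  exists2 f : V -> F, (forall a u v, f (a *: u + v) = a * f u + f v) & f y = 1.
Proof.
move=> y0.
pose subsp (W : set V) := forall a u v, W u -> W v -> W (a *: u + v).
have [W [[Wlin Wy] Wmax]] : exists W, (subsp W /\ ~ W y) /\
    forall B, W `<` B -> ~ (subsp B /\ ~ B y).
  apply: (@Zorn_bigcup _ [set W | subsp W /\ ~ W y]) => C CP tot; split.
    move=> a u v [W1 CW1 W1u] [W2 CW2 W2v].
    have [W12|W21] := tot _ _ CW1 CW2.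
      by exists W2 => //; apply: (CP _ CW2).1 => //; exact: W12.
    by exists W1 => //; apply: (CP _ CW1).1 => //; exact: W21.
  by move=> [W CW]; exact: (CP _ CW).2.
have W0 : W 0.
  apply: contrapT => W0.
  have We u : ~ W u.
    by move=> Wu; apply: W0; rewrite -(addNr u) -scaleN1r; exact: Wlin.
  apply: (Wmax [set 0]).
    split; first by move=> u /We.
    by move=> /(_ 0 erefl).
  split; first by move=> a u v -> ->; rewrite scaler0 addr0.
  by move=> /= /eqP; exact/negP.
have WN u : W u -> W (- u) by move=> Wu; rewrite -scaleN1r -[_ *: _]addr0; exact: Wlin.
have WD u v : W u -> W v -> W (u + v).
  by move=> Wu Wv; rewrite -[u]scale1r; exact: Wlin.
have WZ a u : W u -> W (a *: u).
  by move=> Wu; rewrite -[_ *: _]addr0; exact: Wlin.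
have span v : exists a, W (v - a *: y).
  have [Wv|Wv] := pselect (W v); first by exists 0; rewrite scale0r subr0.
  pose B := [set u | exists b, W (u - b *: v)].
  have WB : W `<` B.
    split; first by move=> u Wu; exists 0; rewrite scale0r subr0.
    by move=> /(_ v); apply: contra_not Wv; apply; exists 1; rewrite scale1r subrr.
  have BP : subsp B.
    move=> a u1 u2 [b1 W1] [b2 W2]; exists (a * b1 + b2).
    rewrite scalerDl -scalerA opprD addrACA -scalerBr.
    by apply: WD => //; exact: WZ.
  have [b Wb] : B y by apply: contrapT => By; exact: (Wmax _ WB).
  have b0 : b != 0.
    by apply: contra_notN Wy => /eqP b0; move: Wb; rewrite b0 scale0r subr0.
  exists b^-1; have := WZ (- b^-1) _ Wb.
  by rewrite scalerBr scalerA mulNr mulVf// !scaleNr opprK scale1r addrC.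
have uniq_coef a b v : W (v - a *: y) -> W (v - b *: y) -> a = b.
  move=> Wa Wb; apply/eqP; rewrite -subr_eq0; apply: contra_notT Wy => ab.
  have := WD _ _ Wb (WN _ Wa).
  rewrite opprB addrC addrA subrK -scalerBl => /(WZ (a - b)^-1).
  by rewrite scalerA mulVf// scale1r.
have /choice[f Wf] := span; exists f.
  move=> a u v; apply: uniq_coef (Wf _) _.
  by rewrite scalerDl -scalerA opprD addrACA -scalerBr; apply: WD => //; exact: WZ.
by apply: uniq_coef (Wf _) _; rewrite scale1r subrr.
Qed.

End SeparatingFunctional.

Section Extension.
Variables (R : realType) (k : scalar_kind).
Local Notation K := (KK R k).

(** Completeness stated with Cauchy sequences and the real-valued norm, so that
    Banach spaces and the scalar field [K^o] can be treated alike. *)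
Definition seq_complete (Y : normedModType K) := forall s : nat -> Y,
  (forall e : R, 0 < e -> exists n0, forall i j, (n0 <= i)%N -> (n0 <= j)%N ->
     rnorm (s i - s j) < e) ->
  exists l, forall e : R, 0 < e -> exists n0, forall i, (n0 <= i)%N ->
     rnorm (s i - l) < e.

Lemma complete_seq_complete (Y : completeNormedModType K) : seq_complete Y.
Proof.
move=> s cs.
have : cvg (s n @[n --> \oo]).
  apply/cauchy_cvgP/cauchy_exP => e /= e0.
  have e1 : 0 < to_real e.
    by rewrite -(ltr_of_real k) ge0_to_realK ?of_real0// ltW.
  have [n0 h] := cs _ e1.
  exists (s n0); exists n0 => // n /= n0n; rewrite -ball_normE /=.
  by rewrite normE -[e]ge0_to_realK ?(ltW e0)// ltr_of_real; exact: h.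
move=> /cvg_ex[l sl]; exists l => e e0.
have [|n0 _ h] := sl [set y | rnorm (l - y) < e].
  by apply/nbhs_rnormP; exists e.
by exists n0 => i n0i; rewrite rnormB; exact: h.
Qed.

Lemma real_seq_complete (s : nat -> R) :
  (forall e : R, 0 < e -> exists n0, forall i j, (n0 <= i)%N -> (n0 <= j)%N ->
     `|s i - s j| < e) ->
  exists l, forall e : R, 0 < e -> exists n0, forall i, (n0 <= i)%N ->
     `|s i - l| < e.
Proof.
move=> cs.
have : cvg (s n @[n --> \oo]).
  apply/cauchy_cvgP/cauchy_exP => e /= e0.
  have [n0 h] := cs _ e0.
  by exists (s n0); exists n0 => // n /= n0n; rewrite -ball_normE /=; exact: h.
move=> /cvg_ex[l /cvgrPdist_lt sl]; exists l => e e0.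
have [n0 _ h] := sl e e0.
by exists n0 => i n0i; rewrite distrC; exact: h.
Qed.

Lemma scalar_seq_complete : seq_complete (K^o).
Proof.
rewrite /seq_complete; case: k => /= s cs; first exact: real_seq_complete.
have normE (a b : R) :
    @rnorm R ComplexScalars (R[i]^o) (Complex a b) = Num.sqrt (a ^+ 2 + b ^+ 2).
  by [].
have re_le (z : R[i]) : `|complex.Re z| <= @rnorm R ComplexScalars (R[i]^o) z.
  by case: z => a b; rewrite normE /= -sqrtr_sqr ler_wsqrtr// lerDl sqr_ge0.
have im_le (z : R[i]) : `|complex.Im z| <= @rnorm R ComplexScalars (R[i]^o) z.
  by case: z => a b; rewrite normE /= -sqrtr_sqr ler_wsqrtr// lerDr sqr_ge0.
have le_reim (z : R[i]) :
    @rnorm R ComplexScalars (R[i]^o) z <= `|complex.Re z| + `|complex.Im z|.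
  case: z => a b; rewrite normE /= -[leRHS]ger0_norm ?addr_ge0//.
  rewrite -sqrtr_sqr ler_wsqrtr// sqrrD !real_normK ?num_real//.
  by rewrite addrAC lerDl mulrn_wge0// mulr_ge0.
have ReB (z w : R[i]) : complex.Re (z - w) = complex.Re z - complex.Re w
  by case: z; case: w.
have ImB (z w : R[i]) : complex.Im (z - w) = complex.Im z - complex.Im w
  by case: z; case: w.
have [|a ha] := @real_seq_complete (fun n => complex.Re (s n)).
  move=> e e0; have [n h] := cs e e0; exists n => i j ni nj.
  by rewrite -ReB; apply: le_lt_trans (re_le _) _; exact: h.
have [|b hb] := @real_seq_complete (fun n => complex.Im (s n)).
  move=> e e0; have [n h] := cs e e0; exists n => i j ni nj.
  by rewrite -ImB; apply: le_lt_trans (im_le _) _; exact: h.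
exists (Complex a b) => e e0; have e20 : 0 < e / 2 by rewrite divr_gt0.
have [n1 h1] := ha _ e20; have [n2 h2] := hb _ e20.
exists (maxn n1 n2) => i; rewrite geq_max => /andP[i1 i2].
apply: le_lt_trans (le_reim _) _; rewrite ReB ImB [ltRHS]splitr ltrD//.
  exact: h1.
exact: h2.
Qed.

Variables (V : lmodType K) (N : seminorm V) (Y : normedModType K).

Lemma linear_rnorm_continuous (Z : normedModType K) (u : Z -> Y) (M : R) :
  linear u -> (forall z, rnorm (u z) <= M * rnorm z) -> continuous u.
Proof.
move=> ul uM z U /nbhs_rnormP[e e0 H]; apply/nbhs_rnormP.
have M0 : 0 < `|M| + 1 by rewrite ltr_wpDl.
exists (e / (`|M| + 1)); first exact: divr_gt0.
move=> w zw; apply: H.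
rewrite -(linear_funB ul).
apply: le_lt_trans (uM _) _; move: zw; rewrite ltr_pdivlMr// => /(le_lt_trans _); apply.
by rewrite mulrC ler_wpM2l ?rnorm_ge0// (le_trans (ler_norm _))// lerDl.
Qed.

(** A bounded linear map into a complete space extends to the completion. The
    value at [z] is characterized as the only [y] such that
    [rnorm (y - u v) <= M * rnorm (z - iota v)] for every [v];
    uniqueness and linearity are read off this relation. *)
Lemma extend_completion (u : V -> Y) (M : R) : seq_complete Y -> linear u -> 0 <= M ->
  (forall v, rnorm (u v) <= M * N v) ->
  exists w : completion N -> Y, [/\ linear w, forall z, rnorm (w z) <= M * rnorm z &
    forall v, w (to_completion N v) = u v].
Proof.
move=> Yc ul M0 uM.
pose iota := to_completion N.
pose G z y := forall v, rnorm (y - u v) <= M * rnorm (z - iota v).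
have tri (W : normedModType K) (a b c : W) :
    rnorm (a - b) <= rnorm (a - c) + rnorm (c - b).
  by rewrite -[a - b](subrKA c) ler_rnormD.
have M1 : 0 < M + 1 by rewrite ltr_wpDl.
have small (z : completion N) (e : R) : 0 < e -> exists v, M * rnorm (z - iota v) < e.
  move=> e0; have [v zv] := to_completion_dense z (divr_gt0 e0 M1).
  exists v; move: zv; rewrite ltr_pdivlMr// => /(le_lt_trans _); apply.
  by rewrite mulrC ler_wpM2l ?rnorm_ge0// lerDl.
have uiota v w : rnorm (u v - u w) <= M * rnorm (iota v - iota w).
  by rewrite -(linear_funB ul) -linearB rnorm_to_completion.
have Gex z : exists y, G z y.
  have d0 n : 0 < n.+1%:R^-1 :> R by rewrite invr_gt0.
  have /choice[v hv] n := small z _ (d0 n).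
  have dsmall (e : R) : 0 < e -> exists n, forall i, (n <= i)%N -> i.+1%:R^-1 < e.
    move=> e0; exists (Num.truncn e^-1) => i ni.
    rewrite -[ltRHS]invrK ltf_pV2 ?posrE ?invr_gt0//.
    by apply: lt_le_trans (truncnS_gt _) _; rewrite ler_nat.
  have zvs (e : R) : 0 < e -> exists n, forall i, (n <= i)%N ->
      M * rnorm (z - iota (v i)) < e.
    by move=> /dsmall[n hn]; exists n => i /hn; exact: lt_trans.
  have [|y hy] := Yc (u \o v).
    move=> e e0; have [n hn] := zvs (e / 2) (divr_gt0 e0 (ltr0Sn _ _)).
    exists n => i j ni nj; apply: le_lt_trans (uiota _ _) _.
    apply: le_lt_trans (ler_wpM2l M0 (tri _ _ _ z)) _.
    by rewrite mulrDr [ltRHS]splitr ltrD//; [rewrite rnormB|]; exact: hn.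
  exists y => w; apply/ler_addgt0Pr => e e0.
  have e20 : 0 < e / 2 by rewrite divr_gt0.
  have [n1 h1] := zvs _ e20; have [n2 h2] := hy _ e20.
  pose n := maxn n1 n2.
  have /ltW a1 := h1 n (leq_maxl _ _); have /ltW a2 := h2 n (leq_maxr _ _).
  apply: le_trans (tri _ _ _ (u (v n))) _; rewrite [in leLHS]rnormB.
  apply: le_trans (lerD a2 (uiota _ _)) _.
  have := ler_wpM2l M0 (tri _ (iota (v n)) (iota w) z).
  rewrite mulrDr [rnorm (iota (v n) - z)]rnormB; lra.
have Guniq z y1 y2 : G z y1 -> G z y2 -> y1 = y2.
  move=> G1 G2; apply/eqP; rewrite -subr_eq0; apply/eqP/(@rnorm_eq0 R k).
  apply/eqP; rewrite eq_le rnorm_ge0 andbT; apply/ler_addgt0Pr => e e0.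
  have [v hv] := small z (e / 2) (divr_gt0 e0 (ltr0Sn _ _)).
  apply: le_trans (tri _ _ _ (u v)) _; rewrite [X in _ + X]rnormB.
  have := G1 v; have := G2 v; move: hv; lra.
have /choice[w Gw] := Gex; exists w; split.
- move=> a z1 z2; apply: Guniq (Gw _) _ => v; apply/ler_addgt0Pr => e e0.
  have a0 : 0 < rnorm a + 1 by rewrite ltr_wpDl ?rnorm_ge0.
  have [v1 h1] := small z1 (e / 4 / (rnorm a + 1))
    (divr_gt0 (divr_gt0 e0 (ltr0Sn _ _)) a0).
  have [v2 h2] := small z2 (e / 4) (divr_gt0 e0 (ltr0Sn _ _)).
  have {}h1 : rnorm a * (M * rnorm (z1 - iota v1)) <= e / 4.
    move: h1; rewrite ltr_pdivlMr// => /ltW; apply: le_trans.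
    by rewrite mulrC ler_wpM2l ?mulr_ge0 ?rnorm_ge0// lerDl.
  have g1 := ler_wpM2l (rnorm_ge0 a) (Gw z1 v1); have g2 := Gw z2 v2.
  have E (W : normedModType K) (b1 b2 c1 c2 : W) :
      rnorm ((a *: b1 + b2) - (a *: c1 + c2)) <=
      rnorm a * rnorm (b1 - c1) + rnorm (b2 - c2).
    by rewrite opprD addrACA -scalerBr -rnormZ ler_rnormD.
  have t1 := tri _ (a *: w z1 + w z2) (u v) (u (a *: v1 + v2)).
  have t2 : rnorm ((a *: w z1 + w z2) - u (a *: v1 + v2)) <= e / 4 + e / 4.
    by rewrite ul; apply: le_trans (E _ _ _ _ _) _; move: h1 h2 g1 g2; lra.
  have t3 := uiota (a *: v1 + v2) v.
  have t4 := ler_wpM2l M0 (tri _ (iota (a *: v1 + v2)) (iota v) (a *: z1 + z2)).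
  have t5 : M * rnorm (iota (a *: v1 + v2) - (a *: z1 + z2)) <= e / 4 + e / 4.
    rewrite rnormB /iota linearP; apply: le_trans (ler_wpM2l M0 (E _ _ _ _ _)) _.
    by rewrite mulrDr mulrCA; move: h1 h2; lra.
  rewrite mulrDr in t4; lra.
- move=> z; have i0 : iota 0 = 0 by exact: linear0.
  have := Gw z 0; rewrite (linear_fun0 ul) i0.
  by rewrite [w z - 0]subr0 [z - 0]subr0.
- by move=> v; apply: Guniq (Gw _) _ => t; exact: uiota.
Qed.

End Extension.

(** * Finite lp norms *)

Section LpNorm.
Variables (R : realType) (p : R).
Hypothesis p1 : 1 <= p.
Implicit Types n : nat.

Let p_gt0 : 0 < p. Proof. exact: lt_le_trans ltr01 p1. Qed.
Let p_neq0 : p != 0. Proof. by rewrite gt_eqF. Qed.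

Lemma powR_convex_le (t x y : R) : 0 <= t -> t <= 1 -> 0 <= x -> 0 <= y ->
  (t * x + (1 - t) * y) `^ p <= t * x `^ p + (1 - t) * y `^ p.
Proof.
move=> t0 t1 x0 y0.
have := @convex_powR R p p1 (Itv01 t0 t1) x y.
by rewrite !inE /= !in_itv /= !andbT !convRE /= => /(_ x0 y0).
Qed.

Lemma lpnorm_ge0 n (a : 'I_n -> R) : 0 <= lpnorm p a.
Proof. exact: powR_ge0. Qed.

Lemma lpnorm_powR n (a : 'I_n -> R) : lpnorm p a `^ p = \sum_(j < n) a j `^ p.
Proof.
rewrite /lpnorm -powRrM mulVf// powRr1//.
by apply: sumr_ge0 => j _; exact: powR_ge0.
Qed.

Lemma lpnorm_le n (a b : 'I_n -> R) :
  (forall j, 0 <= a j) -> (forall j, a j <= b j) -> lpnorm p a <= lpnorm p b.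
Proof.
move=> a0 ab; apply: ge0_ler_powR; rewrite ?nnegrE ?invr_ge0 ?(ltW p_gt0)//.
- by apply: sumr_ge0 => j _; exact: powR_ge0.
- by apply: sumr_ge0 => j _; exact: powR_ge0.
apply: ler_sum => j _; apply: ge0_ler_powR; rewrite ?nnegrE ?(ltW p_gt0)//.
exact: le_trans (ab j).
Qed.

Lemma lpnorm_le_of_powR n (a : 'I_n -> R) (s : R) : 0 <= s ->
  \sum_(j < n) a j `^ p <= s `^ p -> lpnorm p a <= s.
Proof.
move=> s0 H; rewrite -[leRHS](powRr1 s0) -(mulfV p_neq0) powRrM.
apply: ge0_ler_powR; rewrite ?nnegrE ?invr_ge0 ?powR_ge0 ?(ltW p_gt0)//.
by apply: sumr_ge0 => j _; exact: powR_ge0.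
Qed.

Lemma lpnormZ n (c : R) (a : 'I_n -> R) : 0 <= c -> (forall j, 0 <= a j) ->
  lpnorm p (fun j => c * a j) = c * lpnorm p a.
Proof.
move=> c0 a0; rewrite /lpnorm; under eq_bigr do rewrite powRM//.
rewrite -mulr_sumr powRM ?powR_ge0//; last first.
  by apply: sumr_ge0 => j _; exact: powR_ge0.
by rewrite -powRrM mulfV// powRr1.
Qed.

Lemma lpnorm_eq0 n (a : 'I_n -> R) : (forall j, 0 <= a j) ->
  lpnorm p a = 0 -> forall j, a j = 0.
Proof.
move=> a0 A0 j; have := lpnorm_powR a; rewrite A0 powR0// => /esym/eqP.
rewrite psumr_eq0; last by move=> i _; exact: powR_ge0.
by move=> /allP/(_ j (mem_index_enum _))/eqP/powR_eq0_eq0.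
Qed.

(** Minkowski's inequality when the norms [A] of [a] and [B] of [b] are nonzero:
    convexity of the power function, with weights [A / (A + B)] and
    [B / (A + B)]. *)
Lemma lpnormD_pos n (a b : 'I_n -> R) (A B : R) :
  (forall j, 0 <= a j) -> (forall j, 0 <= b j) -> 0 < A -> 0 < B ->
  \sum_(j < n) a j `^ p = A `^ p -> \sum_(j < n) b j `^ p = B `^ p ->
  lpnorm p (fun j => a j + b j) <= A + B.
Proof.
move=> a0 b0 A1 B1 sa sb.
have s0 : 0 < A + B by rewrite addr_gt0.
have A0 : A != 0 by rewrite gt_eqF.
have B0 : B != 0 by rewrite gt_eqF.
apply: lpnorm_le_of_powR; first exact: ltW.
pose t := A / (A + B).
have t0 : 0 <= t by rewrite divr_ge0// ltW.
have t1 : t <= 1 by rewrite ler_pdivrMr// mul1r lerDl ltW.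
have tE : 1 - t = B / (A + B) by rewrite /t; field; rewrite gt_eqF.
have scaled (c : R) (C : R) : 0 <= c -> 0 < C -> (c / C) `^ p = c `^ p / C `^ p.
  by move=> c0 C0; rewrite powRM ?invr_ge0 ?(ltW C0)// -powR_inv1 ?(ltW C0)//
    -powRrM mulN1r powRN.
have key j : (a j + b j) `^ p <=
    (A + B) `^ p * (t * (a j `^ p / A `^ p) + (1 - t) * (b j `^ p / B `^ p)).
  have -> : a j + b j = (A + B) * (t * (a j / A) + (1 - t) * (b j / B)).
    by rewrite tE /t; field; rewrite A0 B0 gt_eqF.
  rewrite powRM ?(ltW s0)//; last first.
    by apply: addr_ge0; apply: mulr_ge0; rewrite ?subr_ge0//;
      apply: divr_ge0 => //; exact: ltW.
  rewrite ler_wpM2l ?powR_ge0// -!scaled//.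
  by apply: powR_convex_le => //; apply: divr_ge0 => //; exact: ltW.
apply: le_trans (ler_sum _ (fun j _ => key j)) _.
rewrite -mulr_sumr big_split /= -!mulr_sumr -!mulr_suml sa sb.
by rewrite !mulfV ?gt_eqF ?powR_gt0// !mulr1 addrC subrK mulr1.
Qed.

(** Minkowski's inequality *)
Lemma lpnormD n (a b : 'I_n -> R) : (forall j, 0 <= a j) -> (forall j, 0 <= b j) ->
  lpnorm p (fun j => a j + b j) <= lpnorm p a + lpnorm p b.
Proof.
move=> a0 b0.
have [A0|A0] := eqVneq (lpnorm p a) 0.
  rewrite A0 add0r; apply: lpnorm_le => j; first exact: addr_ge0.
  by rewrite (lpnorm_eq0 a0 A0) add0r.
have [B0|B0] := eqVneq (lpnorm p b) 0.
  rewrite B0 addr0; apply: lpnorm_le => j; first exact: addr_ge0.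
  by rewrite (lpnorm_eq0 b0 B0) addr0.
apply: lpnormD_pos => //; rewrite ?lpnorm_powR//.
  by rewrite lt_neqAle eq_sym A0 lpnorm_ge0.
by rewrite lt_neqAle eq_sym B0 lpnorm_ge0.
Qed.

End LpNorm.

(** * Symmetric tensors and linearization *)

Section TensorLinearization.
Variables (R : realType) (k : scalar_kind) (m : nat).
Local Notation K := (KK R k).
Hypothesis m0 : (0 < m)%N.
Variables (X Y : normedModType K).

(** Finite weighted sums of values of [P]: the combination of [P] encoded by a
    list of pairs (coefficient, point). *)
Definition wsum (V : lmodType K) (P : X -> V) (s : seq (K * X)) : V :=
  \sum_(u <- s) u.1 *: P u.2.

Lemma wsum_nth (V : lmodType K) (P : X -> V) (s : seq (K * X)) n : (size s <= n)%N ->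
  \sum_(i < n) (nth (0, 0) s i).1 *: P (nth (0, 0) s i).2 = wsum P s.
Proof.
move=> sn; rewrite /wsum (big_nth (0, 0)) big_mkord.
rewrite [RHS](big_ord_widen n (fun i => (nth (0, 0) s i).1 *: P (nth (0, 0) s i).2))//.
rewrite [RHS]big_mkcond; apply: eq_bigr => i _; case: ltnP => // si.
by rewrite nth_default// scale0r.
Qed.

Lemma tcomb_eval (s : seq (K * X)) (B : mform m X) :
  tcomb (m := m) s B = wsum (fun x => sval B (fun=> x) : K^o) s.
Proof. by rewrite /tcomb /wsum fct_sumE. Qed.

(** A relation between tensor powers holds between the values of any vector-valued
    [m]-homogeneous polynomial: otherwise a functional [f] separating the two
    sides would give an [m]-linear form [f \o A] violating the relation. *)
Lemma wsum_wd (A : ('I_m -> X) -> Y) (s t : seq (K * X)) : mlinear A ->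
  tcomb (m := m) s = tcomb (m := m) t ->
  wsum (fun x => A (fun=> x)) s = wsum (fun x => A (fun=> x)) t.
Proof.
move=> Al st; apply/eqP; rewrite -subr_eq0; apply: contraT => /separating_functional.
move=> [f fl f1]; pose g : Y -> K^o := f.
have gl : linear g by exact: fl.
have Bl : mlinear (fun x => g (A x) : K^o) by move=> i x a u v; rewrite Al gl.
pose B : mform m X := exist _ _ Bl.
have gs r : g (wsum (fun x => A (fun=> x)) r) = tcomb (m := m) r B.
  rewrite tcomb_eval /wsum (linear_fun_sum gl); apply: eq_bigr => u _.
  by rewrite (linear_funZ gl).
move: f1; rewrite -/g (linear_funB gl) !gs st subrr => /esym/eqP.
by rewrite oner_eq0.
Qed.

Lemma symtensor_wsum (z : symtensor m X) (s : seq (K * X)) :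
  val z = tcomb (m := m) s -> z = wsum (@sympow R k m X) s.
Proof.
have vl : linear (val : symtensor m X -> mform m X -> K^o) by [].
move=> zs; apply: val_inj; rewrite zs /tcomb /wsum [RHS](linear_fun_sum vl).
by apply: eq_bigr.
Qed.

Lemma symtensor_rep (z : symtensor m X) : exists s, val z = tcomb (m := m) s.
Proof. by case: z => z /= /asboolP. Qed.

Lemma tensor_linearization (P : X -> Y) (M : R) : cpoly m P -> 0 <= M ->
  (forall x, rnorm (P x) <= M * rnorm x ^+ m) ->
  exists u : symtensor m X -> Y, [/\ linear u, forall x, u (sympow m x) = P x &
    forall z, rnorm (u z) <= M * pi_s z].
Proof.
move=> [[A Al PA] _]; have {PA} -> : P = fun x => A (fun=> x) by apply/funext.
move=> M0 PM; pose P' (x : X) := A (fun=> x).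
have /choice[r hr] := symtensor_rep.
exists (fun z => wsum P' (r z)).
have uE z s : val z = tcomb (m := m) s -> wsum P' (r z) = wsum P' s.
  by move=> zs; apply: wsum_wd => //; rewrite -hr.
split.
- move=> a z1 z2; rewrite (uE _ (tscale a (r z1) ++ r z2)); last first.
    by rewrite tcomb_cat tcombZ -!hr.
  rewrite /wsum big_cat /= big_map scaler_sumr; congr (_ + _).
  by apply: eq_bigr => u _; rewrite scalerA.
- move=> x; rewrite (uE _ [:: (1, x)]) /wsum /tcomb /=.
    by rewrite big_seq1 scale1r.
  by rewrite big_seq1 scale1r.
- move=> z; apply/ler_addgt0Pr => e e0.
  have M1 : 0 < M + 1 by rewrite ltr_wpDl.
  have [s zs lts] := pi_s_adherent z (divr_gt0 e0 M1).
  rewrite (uE _ _ zs); apply: le_trans (rnorm_sum _ _ _) _.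
  apply: (@le_trans _ _ (M * tcost m s)).
    rewrite /tcost mulr_sumr; apply: ler_sum => u _.
    rewrite rnormZ mulrCA; apply: ler_wpM2l; [exact: rnorm_ge0|exact: PM].
  apply: le_trans (ler_wpM2l M0 (ltW lts)) _.
  rewrite mulrDr lerD2l mulrCA ler_piMr ?(ltW e0)//.
  by rewrite ler_pdivrMr// mul1r lerDl.
Qed.

(** Although [sympow] only provides powers of a single vector, its polarization
    is the canonical symmetric [m]-linear map into the symmetric tensors: both
    facts below are checked by evaluating at an [m]-linear form. *)
Lemma polarization_sympow_diag (V : lmodType K) (g : symtensor m X -> V) x : linear g ->
  polarization (fun u => g (sympow m u)) (fun _ : 'I_m => x) = g (sympow m x).
Proof.
move=> gl; rewrite -(polarization_comp (sympow m (X := X)) _ gl); congr g.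
apply: val_inj; apply/funext => B.
have el : linear (fun z : symtensor m X => val z B : K^o) by [].
rewrite (polarization_comp (sympow m (X := X)) _ el).
exact: (polarization_cst m0 (svalP B) x).
Qed.

Lemma polarization_sympow_mlinear (g : symtensor m X -> Y) : linear g ->
  mlinear (polarization (m := m) (fun u => g (sympow m u))).
Proof.
move=> gl i x a u v; rewrite -!(polarization_comp (sympow m (X := X)) _ gl).
rewrite -gl; congr g; apply: val_inj; apply/funext => B.
have el : linear (fun z : symtensor m X => val z B : K^o) by [].
rewrite (polarization_comp (sympow m (X := X)) _ el) [RHS]el.
rewrite !(polarization_comp (sympow m (X := X)) _ el).
exact: (mlinear_polarization m0 (svalP B)).
Qed.

Lemma rnorm_symproj_pow (x : X) : rnorm (symproj_pow m x) <= rnorm x ^+ m.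
Proof.
rewrite [leLHS]rnorm_to_completion.
have /pi_s_le : val (sympow m x) = tcomb (m := m) [:: (1, x)].
  by rewrite /tcomb big_seq1 scale1r.
by rewrite /tcost big_seq1 rnorm1 mul1r.
Qed.

Lemma linear_rnorm_le (Z : normedModType K) (f : Z -> Y) z :
  linear f -> (ball_norm f <= 1)%E -> rnorm (f z) <= rnorm z.
Proof.
move=> fl /ball_norm_le1P f1; have [u /f1 u1 zu] := rnorm_normalize z.
rewrite [in leLHS]zu (linear_funZ fl) rnormZ rnorm_of_real ?rnorm_ge0//.
by rewrite ler_piMr ?rnorm_ge0.
Qed.

(** Composing a linear map of norm at most 1 with the tensor power gives a
    polynomial of norm at most 1. *)
Lemma cpoly_comp_symproj_pow (f : symproj m X -> Y) :
  linear f -> (ball_norm f <= 1)%E ->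
  cpoly m (f \o symproj_pow m (X := X)) /\
  (ball_norm (f \o symproj_pow m (X := X)) <= 1)%E.
Proof.
move=> fl f1.
have fle x : rnorm (f (symproj_pow m x)) <= 1 * rnorm x ^+ m.
  by rewrite mul1r (le_trans (linear_rnorm_le _ fl f1))// rnorm_symproj_pow.
pose g z := f (to_completion (@pi_s_seminorm R k m X) z).
have gl : linear g by move=> a u v; rewrite /g linearP fl.
split; last first.
  apply/ball_norm_le1P => x x1; apply: le_trans (fle x) _.
  by rewrite mul1r exprn_ile1 ?rnorm_ge0.
have -> : f \o symproj_pow m (X := X) =
    fun x => polarization (fun u => g (sympow m u)) (fun _ : 'I_m => x).
  by apply/funext => x; rewrite polarization_sympow_diag.
apply: (cpoly_diag m0 (M := 1)) => //; first exact: polarization_sympow_mlinear.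
by move=> x; rewrite polarization_sympow_diag//; exact: fle.
Qed.

(** The extension of polynomials to linear maps, with control of the norm; for
    scalar [P] it is the converse of [cpoly_comp_symproj_pow]. *)
Lemma exists_linearization (P : X -> Y) (M : R) : seq_complete Y -> cpoly m P -> 0 <= M ->
  (forall x, rnorm (P x) <= M * rnorm x ^+ m) ->
  exists w : symproj m X -> Y, [/\ linear w, continuous w,
    forall z, rnorm (w z) <= M * rnorm z & forall x, w (symproj_pow m x) = P x].
Proof.
move=> Yc Pp M0 PM; have [u [ul uP uM]] := tensor_linearization Pp M0 PM.
have [w [wl wM wu]] := extend_completion (N := @pi_s_seminorm R k m X) Yc ul M0 uM.
exists w; split => //; first exact: linear_rnorm_continuous wl wM.
by move=> x; rewrite /symproj_pow wu.
Qed.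

Lemma linearizationP (P : X -> Y) : seq_complete Y -> cpoly m P ->
  [/\ linear (linearization m P), continuous (linearization m P) &
    forall x, linearization m P (symproj_pow m x) = P x].
Proof.
move=> Yc Pp; have [M M0 PM] := cpoly_bounded m0 Pp.
rewrite /linearization; case: xgetP => [w -> //|].
have [w [wl wc _ wP]] := exists_linearization Yc Pp M0 PM.
by move=> /(_ w); case.
Qed.

Lemma symproj_dense (z : symproj m X) (e : R) : 0 < e ->
  exists s : seq (K * X), rnorm (z - wsum (symproj_pow m (X := X)) s) < e.
Proof.
move=> e0; have [v zv] := to_completion_dense z e0.
have [s vs] := symtensor_rep v; exists s.
have il : linear (to_completion (@pi_s_seminorm R k m X)).
  by move=> a u t; exact: linearP.
move: zv; rewrite (symtensor_wsum vs) /wsum (linear_fun_sum il).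
by under eq_bigr do rewrite (linear_funZ il).
Qed.

End TensorLinearization.

(** * Comparison of the summing constants *)

Section SummingConstants.
Variables (R : realType) (k : scalar_kind) (p : R) (m : nat).
Local Notation K := (KK R k).
Hypotheses (p1 : 1 <= p) (m0 : (0 < m)%N).
Variables (X Y : normedModType K) (P : X -> Y).
Hypotheses (Yc : seq_complete Y) (Pp : cpoly m P).

Lemma summing_fst_consts C :
  summing_consts p (linearization m P) C -> fst_poly_consts p m P C.
Proof.
have [wl _ wP] := linearizationP m0 Yc Pp; set w := linearization m P in wl wP *.
move=> [C0 H]; split=> // m1 m2 x l m1_gt0 m2_gt0.
pose z j := \sum_(i < m2) l j i *: symproj_pow m (x j i).
have fz (Z : normedModType K) (f : symproj m X -> Z) j : linear f ->
    f (z j) = \sum_(i < m2) l j i *: f (symproj_pow m (x j i)).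
  move=> fl; rewrite /z (linear_fun_sum fl).
  by apply: eq_bigr => i _; rewrite (linear_funZ fl).
have -> : (fun j => rnorm (\sum_(i < m2) l j i *: P (x j i))) =
          (fun j => rnorm (w (z j))).
  apply/funext => j; rewrite (fz _ _ _ wl); congr rnorm.
  by apply: eq_bigr => i _; rewrite wP.
apply: le_trans (H m1 z) _; apply: lee_wpmul2l; first by rewrite lee_fin.
apply: ge_ereal_sup => _ [f [fl fc f1] <-]; apply: ereal_sup_ubound.
have [qp q1] := cpoly_comp_symproj_pow m0 fl f1.
exists (f \o symproj_pow m (X := X)); first by split.
by congr (lpnorm p _)%:E; apply/funext => j; rewrite (fz _ _ _ fl).
Qed.

Lemma fst_summing_consts C :
  fst_poly_consts p m P C -> summing_consts p (linearization m P) C.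
Proof.
have [wl wc wP] := linearizationP m0 Yc Pp; set w := linearization m P in wl wc wP *.
move=> [C0 H]; split=> // N z.
set S := ereal_sup _.
have S0 : (0 <= S)%E.
  apply: le_trans (_ : (lpnorm p (fun j : 'I_N => rnorm (0 : K^o)))%:E <= S)%E.
    by rewrite lee_fin lpnorm_ge0.
  apply: ereal_sup_ubound; exists (fun=> 0) => //; split.
  - by move=> a u v; rewrite scaler0 addr0.
  - exact: cst_continuous.
  - by apply/ball_norm_le1P => u _; rewrite rnorm0.
(* only nonempty families are tested on the polynomial side *)
have [N0|N_gt0] := posnP N.
  have pV0 : p^-1 != 0 by rewrite invr_eq0 gt_eqF// (lt_le_trans ltr01 p1).
  rewrite /lpnorm big1 => [|j]; last by have := ltn_ord j; rewrite [X in (_ < X)%N]N0.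
  by rewrite powR0// mule_ge0.
pose n1 := lpnorm p (fun _ : 'I_N => 1).
have n1_ge0 : 0 <= n1 by exact: lpnorm_ge0.
apply/lee_addgt0Pr => e e0.
(* the accuracy [d] enters once through [w] and once, multiplied by [C], through
   the functionals *)
pose D := n1 * (C + 1) + 1.
have D0 : 0 < D by rewrite ltr_wpDl// mulr_ge0// addr_ge0.
pose d := e / D.
have d0 : 0 < d by rewrite divr_gt0.
have lpd : lpnorm p (fun _ : 'I_N => d) = d * n1.
  rewrite -(lpnormZ p1 (a := fun _ : 'I_N => 1) (ltW d0) (fun=> ler01)).
  by congr lpnorm; apply/funext => j; rewrite mulr1.
(* approximate each [z j] by a finite tensor *)
have /choice[s hs] j : exists s, rnorm (z j - wsum (symproj_pow m (X := X)) s) < d /\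
    rnorm (w (z j) - w (wsum (symproj_pow m (X := X)) s)) < d.
  have /nbhs_rnormP[d' d'0 hd'] : nbhs (z j) [set t | rnorm (w (z j) - w t) < d].
    apply: (wc (z j) [set t | rnorm (w (z j) - t) < d]).
    by apply/nbhs_rnormP; exists d.
  have dd : 0 < Num.min d d' by rewrite lt_min d0.
  have [s] := symproj_dense (z j) dd; rewrite lt_min => /andP[sd sd'].
  by exists s; split => //; exact: hd'.
pose z' j := wsum (symproj_pow m (X := X)) (s j).
(* the lists [s j] are padded with null terms to a common length *)
pose m2 := (\max_(j < N) size (s j)).+1.
have sm2 j : (size (s j) <= m2)%N.
  by apply: leqW; exact: (leq_bigmax j).
pose x j (i : 'I_m2) := (nth (0, 0) (s j) i).2.
pose l j (i : 'I_m2) := (nth (0, 0) (s j) i).1.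
have fz (Z : normedModType K) (f : symproj m X -> Z) j : linear f ->
    f (z' j) = \sum_(i < m2) l j i *: f (symproj_pow m (x j i)).
  move=> fl; rewrite (wsum_nth (fun y => f (symproj_pow m y)) (sm2 j)).
  rewrite /z' /wsum (linear_fun_sum fl).
  by apply: eq_bigr => i _; rewrite (linear_funZ fl).
have lpadd (a b : 'I_N -> R) : (forall j, 0 <= a j) -> (forall j, 0 <= b j) ->
    (forall j, a j <= b j + d) -> lpnorm p a <= lpnorm p b + d * n1.
  move=> a0 b0 ab; rewrite -lpd;
  apply: le_trans (lpnormD p1 b0 _); last by move=> _; exact: ltW.
  exact: lpnorm_le.
have close (Z : normedModType K) (a b : Z) : rnorm (a - b) < d -> rnorm a <= rnorm b + d.
  move=> /ltW ab; rewrite -[in leLHS](subrK b a) addrC.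
  by apply: le_trans (ler_rnormD _ _) _; rewrite lerD2l.
have step1 : lpnorm p (fun j => rnorm (w (z j))) <=
    lpnorm p (fun j => rnorm (w (z' j))) + d * n1.
  by apply: lpadd => j; rewrite ?rnorm_ge0//; apply: close; exact: (hs j).2.
have step2 : ((lpnorm p (fun j => rnorm (w (z' j))))%:E <= C%:E * (S + (d * n1)%:E))%E.
  have -> : (fun j => rnorm (w (z' j))) =
            (fun j => rnorm (\sum_(i < m2) l j i *: P (x j i))).
    apply/funext => j; rewrite (fz _ _ _ wl); congr rnorm.
    by apply: eq_bigr => i _; rewrite wP.
  apply: le_trans (H N m2 x l N_gt0 (ltn0Sn _)) _.
  apply: lee_wpmul2l; first by rewrite lee_fin.
  apply: ge_ereal_sup => _ [q [qp q1] <-].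
  have qle y : rnorm (q y) <= 1 * rnorm y ^+ m.
    by apply: cpoly_le => //; exact/ball_norm_le1P.
  have [f [fl fc f1 fq]] := exists_linearization (@scalar_seq_complete R k) qp ler01 qle.
  apply: (@le_trans _ _ ((lpnorm p (fun j => rnorm (f (z j))))%:E + (d * n1)%:E)%E).
    rewrite -EFinD lee_fin; apply: lpadd => j; rewrite ?rnorm_ge0//.
    have -> : \sum_(i < m2) l j i *: (q (x j i) : K^o) = f (z' j).
      by rewrite (fz _ _ _ fl); apply: eq_bigr => i _; rewrite fq.
    apply: close; rewrite -(linear_funB fl).
    apply: le_lt_trans (f1 _) _; rewrite mul1r rnormB; exact: (hs j).1.
  apply: leeD => //; apply: ereal_sup_ubound; exists f => //; split => //.
  by apply/ball_norm_le1P => u u1; apply: le_trans (f1 _) _; rewrite mul1r.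
apply: (@le_trans _ _ (C%:E * (S + (d * n1)%:E) + (d * n1)%:E)%E).
  apply: le_trans (_ : _ <= (lpnorm p (fun j => rnorm (w (z' j))) + d * n1)%:E)%E _.
    by rewrite lee_fin.
  by rewrite EFinD leeD2r.
have dn0 : 0 <= d * n1 by rewrite mulr_ge0// ltW.
rewrite ge0_muleDr// -addeA leeD2l// -EFinM -EFinD lee_fin.
rewrite (_ : _ + _ = d * (n1 * (C + 1))); last by ring.
apply: (@le_trans _ _ (d * D)); first by rewrite ler_pM2l// lerDl.
by rewrite /d divfK// gt_eqF.
Qed.

Lemma fst_summing_constsE :
  fst_poly_consts p m P = summing_consts p (linearization m P).
Proof.
by apply/seteqP; split => C; [exact: fst_summing_consts|exact: summing_fst_consts].
Qed.

(** Restriction to the diagonal. *)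
Lemma fst_ml_poly_consts C :
  fst_ml_consts p (polar m P) C -> fst_poly_consts p m P C.
Proof.
have [_ _ BP] := polarP m0 Pp.
move=> [C0 H]; split=> // m1 m2 x l m1_gt0 m2_gt0.
have := H m1 m2 (fun j i _ => x j i) l m1_gt0 m2_gt0.
rewrite (_ : (fun j => rnorm (\sum_(i < m2) l j i *: polar m P (fun=> x j i))) =
             (fun j => rnorm (\sum_(i < m2) l j i *: P (x j i)))); last first.
  by apply/funext => j; congr rnorm; apply: eq_bigr => i _; rewrite BP.
move=> /le_trans; apply; apply: lee_wpmul2l; first by rewrite lee_fin.
apply: ge_ereal_sup => _ [f [fc /mnorm_le1P f1] <-]; apply: ereal_sup_ubound.
exists (fun y => f (fun=> y)) => //; split; first exact: cmlinear_cpoly.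
by apply/ball_norm_le1P => y y1; exact: f1.
Qed.

(** Polarization, applied both to [P] and to the test polynomials; the constant
    deteriorates by a factor depending on [m] only. The [+ 1] makes this factor
    obviously positive. *)
Lemma fst_poly_ml_consts C :
  fst_poly_consts p m P C ->
  fst_ml_consts p (polar m P) (C * (polarization_const R k m + 1)).
Proof.
move=> [C0 H]; set c := _ + 1.
have c0 : 0 < c by rewrite ltr_wpDl ?polarization_const_ge0.
split=> [|m1 m2 x l m1_gt0 m2_gt0]; first by rewrite mulr_ge0 ?(ltW c0).
(* combinations of values of the polar are indexed by pairs made of a term and a
   set of slots *)
pose T : finType := ('I_m2 * {set 'I_m})%type.
have T0 : (0 < #|T|)%N.
  by apply/card_gt0P; exists (Ordinal m2_gt0, finset.set0).
pose x' j (i : 'I_#|T|) := \sum_(h in (enum_val i).2) x j (enum_val i).1 h.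
pose l' j (i : 'I_#|T|) : K :=
  l j (enum_val i).1 * (m`!%:R^-1 * (-1) ^+ #|~: (enum_val i).2|).
have sumE (Z : normedModType K) (q : X -> Z) j :
    \sum_(i < #|T|) l' j i *: q (x' j i) = \sum_(i < m2) l j i *: polarization q (x j i).
  transitivity (\sum_(t : T) (l j t.1 * (m`!%:R^-1 * (-1) ^+ #|~: t.2|)) *:
      q (\sum_(h in t.2) x j t.1 h)).
    by rewrite [RHS]big_enum_val.
  rewrite -(pair_big predT predT (fun i S => (l j i * (m`!%:R^-1 * (-1) ^+ #|~: S|)) *:
      q (\sum_(h in S) x j i h))) /=.
  apply: eq_bigr => i _; rewrite /polarization scalerA scaler_sumr.
  by apply: eq_bigr => S _; rewrite scalerA mulrA.
have -> : (fun j => rnorm (\sum_(i < m2) l j i *: polar m P (x j i))) =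
          (fun j => rnorm (\sum_(i < #|T|) l' j i *: P (x' j i))).
  by apply/funext => j; rewrite sumE (polarE m0 Pp).
apply: le_trans (H m1 _ x' l' m1_gt0 T0) _.
rewrite EFinM -muleA; apply: lee_wpmul2l; first by rewrite lee_fin.
apply: ge_ereal_sup => _ [q [qp /ball_norm_le1P q1] <-].
(* the polar of [q], scaled back into the unit ball *)
pose f (y : 'I_m -> X) : K^o := of_real k c^-1 *: polarization q y.
have [[Al _] _ _] := cpoly_polarization m0 qp.
have fl : mlinear f.
  move=> i y a u v; rewrite /f Al scalerDr; congr (_ + _).
  by rewrite !scalerA [a * _]mulrC.
have f1 y : (forall i, rnorm (y i) <= 1) -> rnorm (f y) <= 1.
  move=> y1; rewrite rnormZ rnorm_of_real ?invr_ge0 ?(ltW c0)//.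
  rewrite ler_pdivrMl// mulr1; apply: le_trans (polarization_le ler01 _ y1) _.
    by apply: cpoly_le.
  by rewrite mulr1 lerDl.
have cancel_c (b : K) (v : K^o) : of_real k c *: (b *: (of_real k c^-1 *: v)) = b *: v.
  rewrite !scalerA mulrAC -of_realM mulfV ?gt_eqF//.
  by rewrite (_ : of_real k 1 = 1) ?mul1r// -(rnorm1 R k) -normE normr1.
have -> : (fun j => rnorm (\sum_(i < #|T|) l' j i *: q (x' j i))) =
          (fun j => c * rnorm (\sum_(i < m2) l j i *: f (x j i))).
  apply/funext => j; rewrite sumE -[in RHS](@rnorm_of_real R k c) ?(ltW c0)//.
  rewrite -rnormZ; congr rnorm; rewrite scaler_sumr; apply: eq_bigr => i _.
  exact/esym/cancel_c.
rewrite lpnormZ ?(ltW c0)//; last by move=> j; exact: rnorm_ge0.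
rewrite EFinM; apply: lee_wpmul2l; first by rewrite lee_fin ltW.
apply: ereal_sup_ubound; exists f => //; split; last exact/mnorm_le1P.
split=> //; exact: mlinear_continuous fl f1.
Qed.

End SummingConstants.

Theorem theorem4p8 (R : realType) (k : scalar_kind) (p : R) (m : nat)
    (X Y : completeNormedModType (KK R k)) (P : X -> Y) :
  1 <= p -> (1 <= m)%N -> cpoly m P ->
  [/\ fst_poly p m P <-> abs_summing p (linearization m P),
      fst_poly p m P <-> fst_ml p (polar m P) &
      fst_poly p m P ->
        fst_poly_norm p m P = summing_norm p (linearization m P)].
Proof.
move=> p1 m0 Pp; have Yc := @complete_seq_complete R k Y.
have [wl wc _] := linearizationP m0 Yc Pp.
have [Bc _ _] := polarP m0 Pp.
have consts := fst_summing_constsE p1 m0 Yc Pp.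
split.
- split=> [[_ CP]|[_ _ CP]]; split=> //; by rewrite ?consts// -consts.
- split=> [[_ [C CP]]|[_ [C CB]]]; split=> //.
    by exists (C * (polarization_const R k m + 1)); exact: fst_poly_ml_consts.
  by exists C; exact: fst_ml_poly_consts.
- by move=> _; rewrite /fst_poly_norm consts.
Qed.
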